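(* Let $K$ be a compact Hausdorff space and $n$ a positive integer. (a) If $n$ is odd, then $P\in\mathcal{P}_o(^nC(K))$ is an extreme point of the closed unit ball of the space $(\mathcal{P}_o(^nC(K)),\|\cdot\|_\infty)$ if and only if $P=\pm\delta_t^n$ for some $t\in K$, where $\delta_t^n(x)=x(t)^n$. (b) If $n$ is even, then $P\in\mathcal{P}_o(^nC(K))$ is an extreme point of the closed unit ball of the space $(\mathcal{P}_o(^nC(K)),\|\cdot\|_\infty)$ if and only if $P$ is one of the following: (i) $P=\pm\delta_t^n$ for some $t\in K$, where $\delta_t^n(x)=x(t)^n$; (ii) $P=\delta_s^n-\delta_t^n$, where $s,t$ are distinct points in $K$, and $(\delta_s^n-\delta_t^n)(x)=x(s)^n-x(t)^n$.
   Context: $C(K)$ is the Banach lattice of continuous real functions on $K$ with the supremum norm $\|\cdot\|_\infty$. An $n$-homogeneous polynomial on $C(K)$ is a function $P\colon C(K)\to\mathbb{R}$ of the form $P(x)=A(x,\dots,x)$ with $A$ a bounded $n$-linear form. $P$ is orthogonally additive if $P(x+y)=P(x)+P(y)$ whenever $x,y$ are disjoint, i.e. $|x|\wedge|y|=0$; $\mathcal{P}_o(^nC(K))$ is the space of all such polynomials. It is known that every $P\in\mathcal{P}_o(^nC(K))$ has the form $P(x)=\int_K x^n\,d\mu$ for a regular Borel signed measure $\mu$ on $K$. The norm is $\|P\|_\infty=\sup\{|P(x)|:x\in C(K),\ \|x\|_\infty\le1\}$. *)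

(* Defs.v *)
From HB Require Import structures.
From mathcomp Require Import all_boot all_order all_algebra.
From mathcomp Require Import all_classical all_reals all_analysis.
Set Implicit Arguments.
Unset Strict Implicit.
Unset Printing Implicit Defensive.
Import Order.TTheory GRing.Theory Num.Theory numFieldNormedType.Exports.

Local Open Scope classical_set_scope.
Local Open Scope ring_scope.

(* C(K) is the library's type [continuousType K R] of bundled continuous
   functions; it is given the pointwise vector space structure by presenting it
   as the submodule of continuous functions in the module [K -> R].            *)
Section continuous_lmodule.
Context {K : topologicalType} {R : realType}.

Definition cts : {pred K -> R} := mem [set f : K -> R | continuous f].

Definition cts_sub (f : K -> R) (cf : f \in cts) : continuousType K R :=
  mkcts (set_mem cf : continuous f).

Lemma cts_rect (S : continuousType K R -> Type) :
  (forall f (cf : f \in cts), S (cts_sub cf)) -> forall u, S u.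
Proof.
move=> Sf u.
suff -> : u = cts_sub (mem_set (@cts_fun _ _ u) : (u : K -> R) \in cts).
  exact: Sf.
exact/continuousEP.
Qed.

Lemma cts_subK (f : K -> R) (cf : f \in cts) : cts_sub cf = f :> (K -> R).
Proof. by []. Qed.

HB.instance Definition _ := isSub.Build _ _ (continuousType K R)
  cts_rect cts_subK.

Lemma cts_submod_closed : submod_closed cts.
Proof.
split=> [|a f g /set_mem cf /set_mem cg]; apply/mem_set => x.
  exact: cvg_cst.
by apply: cvgD; [apply: cvgZl_tmp; exact: cf | exact: cg].
Qed.

HB.instance Definition _ := GRing.isSubmodClosed.Build _ _ cts
  cts_submod_closed.
HB.instance Definition _ :=
  [SubChoice_isSubLmodule of continuousType K R by <:].

Lemma ctsDE (x y : continuousType K R) t : (x + y) t = x t + y t.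
Proof. by []. Qed.

Lemma ctsZE a (x : continuousType K R) t : (a *: x) t = a * x t.
Proof. by []. Qed.

End continuous_lmodule.

Section polynomials_on_CK.
Context {K : topologicalType} {R : realType}.
Local Notation CK := (continuousType K R).

Definition sup_norm (x : CK) : R := sup (range (fun t => `|x t|)).

(* |x| /\ |y| = 0; the lattice operations of C(K) are pointwise. *)
Definition disjoint_cts (x y : CK) := forall t, Num.min `|x t| `|y t| = 0.

(* [[eta v with i |-> u]] is the family [v] with its [i]-th entry replaced by
   [u].                                                                        *)
Definition multilinear n (A : ('I_n -> CK) -> R) :=
  forall (i : 'I_n) (v : 'I_n -> CK), scalar (fun u => A [eta v with i |-> u]).

Definition bounded_form n (A : ('I_n -> CK) -> R) :=
  exists M : R, forall v, `|A v| <= M * \prod_(i < n) sup_norm (v i).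

Definition homogeneous_polynomial n (P : CK -> R) :=
  exists A : ('I_n -> CK) -> R,
    [/\ multilinear A, bounded_form A & forall x, P x = A (fun=> x)].

Definition orthogonally_additive (P : CK -> R) :=
  forall x y, disjoint_cts x y -> P (x + y) = P x + P y.

Definition Po n : set (CK -> R) :=
  [set P | homogeneous_polynomial n P /\ orthogonally_additive P].

(* For [P] in [Po n] and [K] compact the set below is bounded and nonempty, so
   that [sup], which is 0 by default otherwise, is the actual supremum.        *)
Definition poly_norm (P : CK -> R) : R :=
  sup [set `|P x| | x in [set x | sup_norm x <= 1]].

Definition Po_unit_ball n : set (CK -> R) :=
  [set P | Po n P /\ poly_norm P <= 1].

Definition delta_pow n (t : K) : CK -> R := fun x => x t ^+ n.

End polynomials_on_CK.

Definition extreme_points (R : realType) (E : lmodType R) (C : set E) : set E :=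
  [set p | C p /\ forall q r (a : R), C q -> C r -> 0 < a < 1 ->
     p = a *: q + (1 - a) *: r -> q = p /\ r = p].

(* Main.v *)
Require Import Defs.
From HB Require Import structures.
From mathcomp Require Import all_boot all_order all_algebra.
From mathcomp Require Import all_classical all_reals all_analysis.
From mathcomp Require Import ring lra zify.
Import Order.TTheory GRing.Theory Num.Theory numFieldNormedType.Exports.
Local Open Scope classical_set_scope.
Local Open Scope ring_scope.

(** The proof passes from polynomials to linear functionals on C(K), and from
there to points of K.

Representation.  Every P in Po n is x |-> L (x^n) for a bounded linear L
([representation]).  Let S be the sum of the n-linear form of P over all
permutations of its arguments.  Polarization writes S(v) as an alternating sum
of the values P(sum of the v_i, i in T), so orthogonal additivity makes S(v)
vanish as soon as the v_i split into two nonempty groups with products zero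
across the groups ([symmetrize_gap]).  Now let 0 <= h <= 1 and decompose N h
with the N + 1 tent functions phi_j centred at the integers: the sum of the
phi_j (N h) is 1, the sum of the j phi_j (N h) is N h, and tents at distance at
least 2 are disjoint.  Splitting every argument of S along the tents and using
the pigeonhole principle, S(phi_j x, phi_k y, ...) = 0 when |j - k| >= n
([gap_tent]).  Hence
N (S(h x, y, ...) - S(x, h y, ...)) = sum (j - k) S(phi_j x, phi_k y, ...)
is bounded independently of N ([balanced_estimate]); dividing by N,
multiplication by h may be moved from one argument to another
([slot_transfer]), and collecting everything in one argument gives
S(x, ..., x) = S(x^n, 1, ..., 1).

The unit ball.  Write L = U - V with U and V positive, U being the positive
part of L ([jordan]).  Taking n-th roots, the x^n with ||x|| <= 1 are the f with
-1 <= f <= 1 if n is odd, and with 0 <= f <= 1 if n is even.  Therefore the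
unit ball consists of the U - V with U(1) + V(1) <= 1 in the odd case, and with
U(1) <= 1 and V(1) <= 1 in the even case ([ball_dpol], [dpol_ball]).

Extreme points are combinations of point masses.  If U - V is extreme and
0 <= phi <= 1, put a = U(phi) / U(1); then U - V is the combination, with
weights a and 1 - a, of U(phi .)/a - V and U((1 - phi) .)/(1 - a) - V, which lie
in the ball because their positive parts have the same value at 1 as U.  So
U(phi f) U(1) = U(phi) U(f): up to a scalar U is a character of C(K), that is,
a multiple of an evaluation ([extreme_multiplicative], [character_eval]).  The
same holds for V, and P = p delta_s^n - q delta_t^n where (p, q) must be an
extreme point other than (0, 0) of a triangle (n odd) or of a square (n even);
s <> t for (p, q) = (1, 1), as 0 is not extreme.

Conversely, let delta_s^n, or delta_s^n - delta_t^n with s <> t and n even, be a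
convex combination of two elements of the ball.  Testing on functions that peak
at s and vanish at t shows that both elements take the extremal values there,
which forces their components U to vanish on every function vanishing at s,
and their components V on every function vanishing at t
([delta_pow_decomposition], [difference_decomposition]). *)

Set Implicit Arguments.
Unset Strict Implicit.
Unset Printing Implicit Defensive.

(** * The ring C(K), the supremum norm and roots *)

Section cts_ring.
Context {K : topologicalType} {R : realType}.
Local Notation CK := (continuousType K R).

Lemma cts_mulr_closed : mulr_closed (@cts K R).
Proof.
split=> [|f g /set_mem cf /set_mem cg]; apply/mem_set => x.
  exact: cvg_cst.
by apply: cvgM; [exact: cf | exact: cg].
Qed.

HB.instance Definition _ := GRing.isMulClosed.Build _ (@cts K R) cts_mulr_closed.
HB.instance Definition _ :=
  GRing.SubZmodule_isSubPzRing.Build _ _ CK (subringClosedP _).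
HB.instance Definition _ := GRing.SubPzRing_isSubComPzRing.Build _ _ CK.

Lemma ctsME (x y : CK) t : (x * y) t = x t * y t.
Proof. by []. Qed.
Lemma cts1E t : (1 : CK) t = 1.
Proof. by []. Qed.
Lemma cts0E t : (0 : CK) t = 0.
Proof. by []. Qed.
Lemma ctsNE (x : CK) t : (- x) t = - x t.
Proof. by []. Qed.
Lemma ctsXE (x : CK) n t : (x ^+ n) t = x t ^+ n.
Proof. by elim: n => // n IH; rewrite !exprS ctsME IH. Qed.
Lemma cts_sumE I r (P : pred I) (F : I -> CK) t :
  (\sum_(i <- r | P i) F i) t = \sum_(i <- r | P i) F i t.
Proof. by elim/big_rec2: _ => // i y x _ <-. Qed.
Definition ctsE := (@ctsDE K R, @ctsZE K R, ctsNE, ctsXE, ctsME, cts1E, cts0E).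

Lemma cts_eq (x y : CK) : (forall t, x t = y t) -> x = y.
Proof. by move=> /continuousEP. Qed.

Lemma scalerM (a : R) (x y : CK) : a *: x * y = a *: (x * y).
Proof. by apply: cts_eq => t; rewrite !ctsE mulrA. Qed.

Section comp.
Variable (r : R -> R).
Hypothesis rc : continuous r.
Variable x : CK.
Lemma cts_comp_subproof : continuous (r \o x).
Proof. by move=> t; apply: continuous_comp; [exact: cts_fun|exact: rc]. Qed.
Definition cts_comp : CK := mkcts cts_comp_subproof.
Lemma cts_compE t : cts_comp t = r (x t).
Proof. by []. Qed.
End comp.
End cts_ring.

Section sup_norm.
Context {K : topologicalType} {R : realType}.
Hypothesis K_nonempty : [set: K] !=set0.
Hypothesis K_compact : compact [set: K].
Local Notation CK := (continuousType K R).

Lemma sup_norm_has_sup (x : CK) : has_sup (range (fun t => `|x t|)).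
Proof.
split; first by case: K_nonempty => t _; exists `|x t|, t.
have cx : {within [set: K], continuous (fun t => `|x t|)}.
  apply/continuous_subspaceT => t.
  by apply: (@continuous_comp _ _ _ x Num.norm);
    [exact: cts_fun | exact: norm_continuous].
have [c _ Hc] := compact_EVT_max K_nonempty K_compact cx.
by exists `|x c| => _ [t _ <-]; apply: Hc; rewrite inE.
Qed.

Lemma ler_sup_norm (x : CK) t : `|x t| <= sup_norm x.
Proof. by apply: sup_upper_bound; [exact: sup_norm_has_sup|exists t]. Qed.

Lemma sup_norm_le (x : CK) c : (forall t, `|x t| <= c) -> sup_norm x <= c.
Proof.
move=> xc; apply: ge_sup; last by move=> _ [t _ <-].
by case: K_nonempty => t _; exists `|x t|, t.
Qed.

Lemma sup_norm_ge0 (x : CK) : 0 <= sup_norm x.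
Proof. by case: K_nonempty => t _; apply: le_trans (ler_sup_norm x t). Qed.

End sup_norm.

Section roots.
Context {R : realType}.

(** (a + b)^n >= a^n + b^n for nonnegative a and b: this is the modulus of
continuity of the n-th root, valid at 0 as well. *)
Lemma nth_root_uniform n (a b : R) : (0 < n)%N -> 0 <= a -> 0 <= b ->
  `|a - b| ^+ n <= `|a ^+ n - b ^+ n|.
Proof.
case: n => // n _.
wlog ab : a b / b <= a.
  move=> W a0 b0; have [ba|/ltW ab] := leP b a; first exact: W.
  by rewrite distrC [X in _ <= X]distrC; apply: W.
move=> a0 b0; rewrite ger0_norm ?subr_ge0// ger0_norm ?subr_ge0 ?lerXn2r//.
rewrite lerBrDr -{2}(subrK b a).
have : 0 <= a - b by rewrite subr_ge0.
move: (a - b) => c c0; elim: n => [|n IH]; first by rewrite !expr1.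
rewrite [leRHS]exprS mulrDl !(exprS _ n.+1).
apply: lerD; apply: ler_wpM2l => //; apply: lerXn2r; rewrite ?nnegrE ?addr_ge0//.
  by rewrite lerDl.
by rewrite lerDr.
Qed.

Definition nth_root n (s : R) : R := Num.max s 0 `^ n%:R^-1.

Lemma nth_root_ge0 n s : 0 <= nth_root n s.
Proof. exact: powR_ge0. Qed.

Lemma nth_rootK n s : (0 < n)%N -> nth_root n s ^+ n = Num.max s 0.
Proof.
move=> n0; rewrite /nth_root -powR_mulrn ?powR_ge0// -powRrM mulVf ?pnatr_eq0 -?lt0n//.
by rewrite powRr1// le_max lexx orbT.
Qed.

Lemma nth_root_continuous n : (0 < n)%N -> continuous (nth_root n).
Proof.
move=> n0 s; apply/cvgrPdist_le => /= e e0.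
near=> t.

have eg : 0 <= e by exact: ltW.
rewrite -(@ler_pXn2r _ n) ?nnegrE//.
apply: le_trans (nth_root_uniform n0 _ _) _; rewrite ?nth_root_ge0//.
rewrite !nth_rootK//; near: t.
have /cvgrPdist_le : Num.max t 0 @[t --> s] --> Num.max s 0.
  by apply: (@continuous_max _ _ id (cst 0)); [exact: cvg_id|exact: cvg_cst].
by apply; rewrite exprn_gt0.
Unshelve. all: by end_near. Qed.


Context {K : topologicalType}.
Local Notation CK := (continuousType K R).

Lemma cts_rootP n (f : CK) : (0 < n)%N -> (forall t, 0 <= f t) ->
  exists x : CK, x ^+ n = f.
Proof.
move=> n0 f0; exists (cts_comp (nth_root_continuous n0) f).
by apply: cts_eq => t; rewrite ctsE cts_compE nth_rootK// max_l.
Qed.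

Lemma max0_continuous : continuous (fun s : R => Num.max s 0).
Proof.
by move=> s; apply: (@continuous_max _ _ id (cst 0)); [exact: cvg_id|exact: cvg_cst].
Qed.

Definition cts_pos : CK -> CK := cts_comp max0_continuous.

Lemma cts_posE (x : CK) t : cts_pos x t = Num.max (x t) 0.
Proof. by []. Qed.

Lemma cts_pos_ge0 (x : CK) t : 0 <= cts_pos x t.
Proof. by rewrite cts_posE le_max lexx orbT. Qed.

Lemma cts_posB (x : CK) : x = cts_pos x - cts_pos (- x).
Proof.
apply: cts_eq => t; rewrite !ctsE !cts_posE ctsNE.
by case: (lerP (x t) 0) => h; case: (lerP (- x t) 0) => h'; lra.
Qed.

(** The signed root is the difference of the roots of the positive and negative
parts, at most one of which is nonzero at each point. *)
Lemma cts_root_odd n (f : CK) : odd n -> exists x : CK, x ^+ n = f.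
Proof.
move=> on; have n0 : (0 < n)%N by case: n on.
have [u uf] := cts_rootP n0 (cts_pos_ge0 f).
have [v vf] := cts_rootP n0 (cts_pos_ge0 (- f)).
exists (u - v); apply: cts_eq => t; rewrite !ctsE.
have ut : u t ^+ n = Num.max (f t) 0 by rewrite -ctsXE uf.
have vt : v t ^+ n = Num.max (- f t) 0 by rewrite -ctsXE vf.
have [h|/ltW h] := lerP 0 (f t).
  move: vt; rewrite max_r ?oppr_le0// => /eqP; rewrite expf_eq0 n0/= => /eqP ->.
  by rewrite subr0 ut max_l.
move: ut; rewrite max_r// => /eqP; rewrite expf_eq0 n0/= => /eqP ->.
by rewrite sub0r exprNn -signr_odd on expr1 mulN1r vt max_l ?oppr_ge0// opprK.
Qed.

End roots.

(** * Expansion of multiadditive maps *)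

Section multiadditive.
Context {V W : zmodType}.

Definition multiadditive n (A : ('I_n -> V) -> W) :=
  forall i v, {morph (fun u => A [eta v with i |-> u]) : x y / x + y}.

Lemma upd_id n (v : 'I_n -> V) i : [eta v with i |-> v i] = v :> (_ -> _).
Proof. by apply: funext => k /=; case: eqP => [->|]. Qed.

Lemma multiadditive0 n (A : ('I_n -> V) -> W) v i :
  multiadditive A -> v i = 0 -> A v = 0.
Proof.
move=> mA vi0; have := mA i v 0 0; rewrite addr0 -vi0 upd_id => /eqP.
by rewrite -subr_eq0 opprD addrA subrr sub0r oppr_eq0 => /eqP.
Qed.

Lemma multiadditive_slot_sum n (A : ('I_n -> V) -> W) v i I (r : seq I) P F :
  multiadditive A ->
  A [eta v with i |-> \sum_(l <- r | P l) F l] =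
  \sum_(l <- r | P l) A [eta v with i |-> F l].
Proof.
move=> mA; apply: (big_morph _ (mA i v)).
by apply: (@multiadditive0 _ _ _ i) => //=; rewrite eqxx.
Qed.

(** Splits the first argument off, for inductions on the number of arguments. *)
Definition consf n (x : V) (v : 'I_n -> V) : 'I_n.+1 -> V :=
  fun i => oapp v x (unlift ord0 i).

Lemma consf_upd0 n (x y : V) (v : 'I_n -> V) :
  [eta consf x v with ord0 |-> y] = consf y v :> (_ -> _).
Proof. by apply: funext => k /=; rewrite /consf; case: unliftP => [j|] ->. Qed.

Lemma consf_upd_lift n (x y : V) (v : 'I_n -> V) i :
  [eta consf x v with lift ord0 i |-> y] = consf x [eta v with i |-> y] :> (_ -> _).
Proof.
apply: funext => k /=; rewrite /consf; case: unliftP => [j|] -> //=.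
Qed.

Lemma consf_multiadditive n (A : ('I_n.+1 -> V) -> W) x :
  multiadditive A -> multiadditive (fun v => A (consf x v)).
Proof. by move=> mA i v y z /=; rewrite -!consf_upd_lift; exact: mA. Qed.

Lemma multiadditive_sum n (A : ('I_n -> V) -> W) (L : finType)
    (w : 'I_n -> L -> V) : multiadditive A ->
  A (fun i => \sum_l w i l) = \sum_(g : {ffun 'I_n -> L}) A (fun i => w i (g i)).
Proof.
elim: n A w => [|n IH] A w mA.
  have E : {ffun 'I_0 -> L} by apply: finfun => -[].
  rewrite (big_pred1 E) => [|g]; first by congr A; apply: funext => -[].
  by apply/esym/eqP/ffunP => -[].
have -> : (fun i => \sum_l w i l) =
    [eta consf 0 (fun i => \sum_l w (lift ord0 i) l)
       with ord0 |-> \sum_l w ord0 l].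
  by apply: funext => k /=; rewrite /consf; case: unliftP => [j|] ->.
rewrite multiadditive_slot_sum//.
transitivity (\sum_l \sum_(g : {ffun 'I_n -> L})
    A (consf (w ord0 l) (fun i => w (lift ord0 i) (g i)))).
  apply: eq_bigr => l _; rewrite consf_upd0.
  exact: (IH _ (fun i => w (lift ord0 i)) (consf_multiadditive _ mA)).
rewrite pair_big.
pose f (p : L * {ffun 'I_n -> L}) : {ffun 'I_n.+1 -> L} :=
  [ffun i => oapp p.2 p.1 (unlift ord0 i)].
pose f' (g : {ffun 'I_n.+1 -> L}) : L * {ffun 'I_n -> L} :=
  (g ord0, [ffun i => g (lift ord0 i)]).
rewrite [RHS](reindex f) /=; last first.
  exists f' => [[l g] _|g _]; rewrite /f /f' /=.
    congr (_, _); first by rewrite ffunE unlift_none.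
    by apply/ffunP => i; rewrite !ffunE liftK.
  apply/ffunP => i. rewrite ffunE. case: unliftP => [j ->|->].
 by rewrite /= ffunE.
 by [].
apply: eq_bigr => -[l g] _ /=; congr A; apply: funext => i.
by rewrite /consf ffunE /=; case: unliftP => [j|] ->.
Qed.

End multiadditive.

Section toggle.
Context {T : finType}.

Definition toggle (a : T) (S : {set T}) :=
  if a \in S then S :\ a else a |: S.

Lemma toggleK a : involutive (toggle a).
Proof.
move=> S; rewrite /toggle; case: (boolP (a \in S)) => aS /=.
  by rewrite finset.setD11 finset.setD1K.
by rewrite finset.setU11 finset.setU1K.
Qed.

Lemma odd_toggle a S : odd #|toggle a S| = ~~ odd #|S|.
Proof.
rewrite /toggle; case: ifPn => aS; last by rewrite cardsU1 aS.
by rewrite [in RHS](cardsD1 a) aS /= negbK.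
Qed.

Lemma in_toggle a S b : b != a -> (b \in toggle a S) = (b \in S).
Proof. by rewrite /toggle => /negPf ba; case: ifP; rewrite !inE ba. Qed.

(** Adding or removing [a] pairs off the subsets with opposite signs. *)
Lemma alternating_sum0 (R : numDomainType) (F : {set T} -> R) a :
  (forall S, F (toggle a S) = F S) -> \sum_(S : {set T}) (-1) ^+ #|S| * F S = 0.
Proof.
move=> Fa; apply/eqP; rewrite -[_ == 0](@mulrn_eq0 _ _ 2) mulr2n.
rewrite {1}(reindex_inj (inv_inj (toggleK a))) -big_split big1//= => S _.
rewrite Fa -mulrDl -(signr_odd _ #|toggle a S|) odd_toggle.
by rewrite signrN signr_odd addNr mul0r.
Qed.
End toggle.

(** * Polarization and symmetrization *)

Section polarization.
Context {V : zmodType} {R : numDomainType}.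

(** Up to sign, the n-th finite difference of [P] at 0 in the directions
[v i]. *)
Definition polar n (P : V -> R) (v : 'I_n -> V) : R :=
  \sum_(T : {set 'I_n}) (-1) ^+ #|T| * P (\sum_(i in T) v i).

Definition symmetrize n (A : ('I_n -> V) -> R) (v : 'I_n -> V) : R :=
  \sum_(g : {ffun 'I_n -> 'I_n} | injectiveb g) A (fun i => v (g i)).

Lemma symmetrize_diag n (A : ('I_n -> V) -> R) (x : V) :
  symmetrize A (fun=> x) = n`!%:R * A (fun=> x).
Proof.
rewrite /symmetrize sumr_const mulr_natl; congr (_ *+ _).
by have := card_inj_ffuns 'I_n 'I_n; rewrite cardsE card_ord ffactnn.
Qed.

(** Expanding all the sums, the term attached to an index map [g] occurs once for
each [T] containing the image of [g].  If [g] misses an index these occurrences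
cancel in pairs; otherwise [g] is a permutation and only the full set remains. *)
Lemma polarization n (A : ('I_n -> V) -> R) v : multiadditive A ->
  polar (fun x => A (fun=> x)) v = (-1) ^+ n * symmetrize A v.
Proof.
move=> mA; rewrite /polar /symmetrize mulr_sumr [RHS]big_mkcond /=.
pose w (T : {set 'I_n}) (l : 'I_n) := if l \in T then v l else 0.
transitivity (\sum_(T : {set 'I_n}) \sum_(g : {ffun 'I_n -> 'I_n})
   (-1) ^+ #|T| * A (fun i => w T (g i))).
  apply: eq_bigr => T _; rewrite -mulr_sumr; congr (_ * _).
  by rewrite -(multiadditive_sum (fun=> w T))//; congr A; rewrite big_mkcond.
rewrite exchange_big; apply: eq_bigr => g _ /=.
case: injectiveP => [g_inj|/injectiveP g_ninj].
  rewrite (bigD1 [set: 'I_n]%SET)//= [X in _ + X]big1 ?addr0.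
    rewrite cardsT card_ord; congr (_ * A _).
    by apply: funext => i; rewrite /w finset.in_setT.
  move=> T TnT; have [b bT] : exists b, b \notin T.
    apply/existsP; rewrite -negb_forall; apply: contra TnT => /forallP h.
    by apply/eqP/setP => b; rewrite h finset.in_setT.
  rewrite (@multiadditive0 _ _ _ _ _ (invF g_inj b) mA) ?mulr0//.
  by rewrite /w f_invF (negPf bT).
have [a ag] : exists a, a \notin codom g.
  apply/existsP; rewrite -negb_forall; apply: contra g_ninj => /forallP h.
  apply: (leq_size_uniq (enum_uniq 'I_n)) => [b _|]; first exact: h.
  by rewrite size_codom -cardE.
apply: (@alternating_sum0 _ _ _ a) => T; congr A; apply: funext => i.
rewrite /w in_toggle//; apply: contraNneq ag => <-; exact: codom_f.
Qed.

(** Each of the two summands does not depend on the membership in [T] of some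
index, [b] for the first and [a] for the second, so its alternating sum is 0. *)
Lemma polar_split n (P : V -> R) (v : 'I_n -> V) (S : {set 'I_n}) a b :
  a \in S -> b \notin S ->
  (forall T : {set 'I_n}, P (\sum_(i in T) v i) =
    P (\sum_(i in T | i \in S) v i) + P (\sum_(i in T | i \notin S) v i)) ->
  polar P v = 0.
Proof.
move=> aS bS PS; rewrite /polar.
under eq_bigr => T _ do rewrite PS mulrDr.
rewrite big_split /= (@alternating_sum0 _ _ _ b); last first.
  move=> T; congr P; apply: eq_bigl => i.
  by case: (eqVneq i b) => [->|ib]; rewrite ?(negPf bS) ?andbF ?in_toggle.
rewrite (@alternating_sum0 _ _ _ a) ?addr0// => T; congr P; apply: eq_bigl => i.
by case: (eqVneq i a) => [->|ia]; rewrite ?aS ?andbF ?in_toggle.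
Qed.

End polarization.

Section symmetrize_CK.
Context {K : topologicalType} {R : realType}.
Local Notation CK := (continuousType K R).

Lemma multilinear_additive n (A : ('I_n -> CK) -> R) :
  multilinear A -> multiadditive A.
Proof.
by move=> mA i v x y; have := mA i v 1 x y; rewrite /= scale1r mul1r.
Qed.

Lemma symmetrize_multilinear n (A : ('I_n -> CK) -> R) :
  multilinear A -> multilinear (symmetrize A).
Proof.
move=> mA k v c x y; rewrite /symmetrize mulr_sumr -big_split /=.
apply: eq_bigr => g /injectiveP g_inj.
have E u : (fun i => [eta v with k |-> u] (g i)) =
    [eta (fun i => v (g i)) with invF g_inj k |-> u] :> (_ -> _).
  by apply: funext => i /=; rewrite -(inj_eq g_inj) f_invF.
by rewrite !E; exact: mA.
Qed.

Lemma symmetrize_bounded n (A : ('I_n -> CK) -> R) :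
  bounded_form A -> bounded_form (symmetrize A).
Proof.
move=> [M AM]; exists (\sum_(g : {ffun 'I_n -> 'I_n} | injectiveb g) M) => v.
apply: le_trans (ler_norm_sum _ _ _) _; rewrite mulr_suml; apply: ler_sum.
move=> g /injectiveP g_inj; apply: le_trans (AM _) _.
by rewrite [X in _ <= _ * X](reindex_inj g_inj).
Qed.

(** The form of disjointness that polarization yields at once: nothing is claimed
about two disjoint arguments that the other arguments may link. *)
Definition gap_vanishing n (B : ('I_n -> CK) -> R) := forall v (S : {set 'I_n}) a b,
  a \in S -> b \notin S ->
  (forall i j, i \in S -> j \notin S -> v i * v j = 0) -> B v = 0.

Lemma disjoint_ctsP (x y : CK) : x * y = 0 -> disjoint_cts x y.
Proof.
move=> xy t; have /eqP : x t * y t = 0 by rewrite -ctsME xy.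
rewrite mulf_eq0 => /orP[]/eqP ->; rewrite normr0; first by rewrite min_l.
by rewrite min_r.
Qed.

Lemma symmetrize_gap n (A : ('I_n -> CK) -> R) : multilinear A ->
  orthogonally_additive (fun x => A (fun=> x)) -> gap_vanishing (symmetrize A).
Proof.
move=> mA oA v S a b aS bS vS.
apply/eqP; rewrite -(mulrI_eq0 _ (@lregX _ (-1) n _)); last first.
  by apply: lregN; exact: lreg1.
rewrite -polarization; last exact: multilinear_additive.
apply/eqP/(@polar_split _ _ n (fun x : CK => A (fun=> x)) v S a b aS bS) => T.
have D : disjoint_cts (\sum_(i in T | i \in S) v i)
                      (\sum_(i in T | i \notin S) v i).
  apply: disjoint_ctsP; rewrite mulr_suml big1// => i /andP[_ iS].
  by rewrite mulr_sumr big1// => j /andP[_ jS]; exact: vS.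
rewrite -(oA _ _ D); congr A; apply: funext => _.
by rewrite (bigID (mem S)).
Qed.
End symmetrize_CK.

(** * Tent functions *)

Section tents.
Context {K : topologicalType} {R : realType}.
Local Notation CK := (continuousType K R).

Lemma tent_continuous (j : nat) : continuous (fun s : R => 1 - `|s - j%:R|).
Proof.
move=> s; apply: cvgB; first exact: cvg_cst.
by apply: cvg_norm; apply: cvgB; [exact: cvg_id|exact: cvg_cst].
Qed.

Definition tent (j : nat) (g : CK) : CK := cts_pos (cts_comp (@tent_continuous j) g).

Lemma tentE j (g : CK) t : tent j g t = Num.max (1 - `|g t - j%:R|) 0.
Proof. by []. Qed.

Lemma tent_ge0 j (g : CK) t : 0 <= tent j g t.
Proof. exact: cts_pos_ge0. Qed.

Lemma tent_eq0 j (g : CK) t : 1 <= `|g t - j%:R| -> tent j g t = 0.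
Proof. by move=> h; rewrite tentE max_r// subr_le0. Qed.

(** Affine functions coincide with their piecewise linear interpolation at the
integers. *)
Lemma tent_affine (s al be : R) N : 0 <= s <= N%:R ->
  \sum_(j < N.+1) (al + be * j%:R) * Num.max (1 - `|s - j%:R|) 0 = al + be * s.
Proof.
elim: N => [|N IH] /andP[s0 sN].
  have -> : s = 0 by apply/eqP; rewrite eq_le sN s0.
  by rewrite big_ord1 subrr normr0 subr0 max_l// mulr1.
rewrite big_ord_recr /=; have [le_sN|lt_Ns] := leP s N%:R.
  rewrite IH ?s0// [Num.max _ _]max_r ?mulr0 ?addr0//.
  by rewrite subr_le0 ler0_norm -natr1; lra.
rewrite big_ord_recr big1 /= ?add0r.
  rewrite -natr1 in sN *.
  rewrite [`|s - N%:R|]ger0_norm ?[`|s - _|]ler0_norm; try lra.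
  by rewrite !max_l; lra.
move=> j _; rewrite max_r ?mulr0// subr_le0.
have : j.+1%:R <= N%:R :> R by rewrite ler_nat.
by rewrite -natr1 => jN; rewrite ger0_norm; lra.
Qed.

Lemma tent_sum (g : CK) N : (forall t, 0 <= g t <= N%:R) ->
  \sum_(j < N.+1) tent j g = 1.
Proof.
move=> gN; apply: cts_eq => t; rewrite cts_sumE ctsE.
have := tent_affine 1 0 (gN t); rewrite mul0r addr0 => <-.
by apply: eq_bigr => j _; rewrite mul0r addr0 mul1r.
Qed.

Lemma tent_sumM (g : CK) N : (forall t, 0 <= g t <= N%:R) ->
  \sum_(j < N.+1) j%:R *: tent j g = g.
Proof.
move=> gN; apply: cts_eq => t; rewrite cts_sumE.
have := tent_affine 0 1 (gN t); rewrite add0r mul1r => <-.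
by apply: eq_bigr => j _; rewrite mul1r add0r.
Qed.

Lemma tent_disjoint i j (g : CK) : (i.+1 < j)%N -> tent i g * tent j g = 0.
Proof.
move=> ij; apply: cts_eq => t; rewrite !ctsE.
have : i%:R + 2 <= j%:R :> R by rewrite -natrD ler_nat addn2.
move=> ijR; have [le_ti|lt_it] := leP (g t) (i%:R + 1).
  by rewrite [tent j g t]tent_eq0 ?mulr0// ler0_norm; lra.
by rewrite tent_eq0 ?mul0r// ger0_norm; lra.
Qed.

(** Split the remaining arguments along the tents too.  In each term the n
arguments occupy at most n layers, including [j] and [k], so at least one layer strictly
between [j] and [k] is empty, and it separates the arguments into two groups. *)
Lemma gap_tent n (B : ('I_n -> CK) -> R) : multilinear B -> gap_vanishing B ->
  forall (g : CK) N, (forall t, 0 <= g t <= N%:R) ->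
  forall (v : 'I_n -> CK) (a b : 'I_n) (j k : 'I_N.+1) x y, a != b ->
  v a = tent j g * x -> v b = tent k g * y -> (j + n <= k)%N -> B v = 0.
Proof.
move=> mB gB g N gN v a b j k x y ab va vb jk.
(* The slots a and b are already localized: their decomposition is trivial. *)
pose w (i : 'I_n) (l : 'I_N.+1) : CK :=
  if i == a then (if l == j then v a else 0) else
  if i == b then (if l == k then v b else 0) else tent l g * v i.
have wE i l : exists z, w i l = tent l g * z.
  rewrite /w; case: ifP => _; last case: ifP => _.
  - by case: eqP => [->|_]; [exists x|exists 0; rewrite mulr0].
  - by case: eqP => [->|_]; [exists y|exists 0; rewrite mulr0].
  - by exists (v i).
have -> : v = fun i => \sum_l w i l.
  apply: funext => i; rewrite /w.
  case: eqP => [->|_]; first by rewrite -big_mkcond big_pred1_eq.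
  case: eqP => [->|_]; first by rewrite -big_mkcond big_pred1_eq.
  by rewrite -mulr_suml tent_sum// mul1r.
rewrite multiadditive_sum; last exact: multilinear_additive.
apply: big1 => f _.
have [faj|faj] := eqVneq (f a) j; last first.
  apply: (@multiadditive0 _ _ _ _ _ a); first exact: multilinear_additive.
  by rewrite /w eqxx (negPf faj).
have [fbk|fbk] := eqVneq (f b) k; last first.
  apply: (@multiadditive0 _ _ _ _ _ b); first exact: multilinear_additive.
  by rewrite /w eq_sym (negPf ab) eqxx (negPf fbk).
(* Otherwise the n + 1 integers from j to j + n would all be values of f. *)
have [c jck cf] : exists2 c, (j < c < k)%N & forall i, (f i : nat) != c.
  apply: contrapT => nc.
  have : (size (iota j n.+1) <= size [seq (f i : nat) | i : 'I_n])%N.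
    apply: uniq_leq_size; first exact: iota_uniq.
    move=> c; rewrite mem_iota => /andP[jc ck].
    apply: contrapT => /negP cn; apply: nc; exists c.
      rewrite !ltn_neqAle jc andbT.
      have -> : (c <= k)%N by lia.
      rewrite andbT; apply/andP; split.
        by apply: contraNneq cn => <-; apply/mapP; exists a; rewrite ?mem_enum ?faj.
      by apply: contraNneq cn => ->; apply/mapP; exists b; rewrite ?mem_enum ?fbk.
    by move=> i; apply: contraNneq cn => <-; apply/mapP; exists i; rewrite ?mem_enum.
  by rewrite size_iota size_map -cardE card_ord ltnn.
apply: (gB _ [set i | (f i < c)%N]%SET a b).
- by rewrite !inE faj; case/andP: jck.
- by rewrite !inE fbk -leqNgt ltnW//; case/andP: jck.
move=> i i'; rewrite !inE -leqNgt => fic cfi'.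
have [z ->] := wE i (f i); have [z' ->] := wE i' (f i').
rewrite mulrACA tent_disjoint ?mul0r// (leq_ltn_trans fic)//.
by rewrite ltn_neqAle cfi' andbT eq_sym cf.
Qed.

End tents.

(** * Representation by linear functionals *)

Section balanced.
Context {K : topologicalType} {R : realType}.
Hypothesis K_nonempty : [set: K] !=set0.
Hypothesis K_compact : compact [set: K].
Local Notation CK := (continuousType K R).

(** Both differences lie strictly between - m and m and are congruent modulo
2 m. *)
Lemma same_difference (j k j' k' m : nat) : (0 < m)%N ->
  (j = j' %[mod 2 * m])%N -> (k = k' %[mod 2 * m])%N ->
  (j < k + m)%N -> (k < j + m)%N -> (j' < k' + m)%N -> (k' < j' + m)%N ->
  (j + k' = j' + k)%N.
Proof.
move=> m0 jj kk h1 h2 h3 h4.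
have := divn_eq j (2 * m); have := divn_eq k (2 * m).
have := divn_eq j' (2 * m); have := divn_eq k' (2 * m).
rewrite jj kk; set r := (j' %% _)%N; set r' := (k' %% _)%N.
move: (j %/ _)%N (k %/ _)%N (j' %/ _)%N (k' %/ _)%N => a b a' b' e1 e2 e3 e4.
move=> {jj kk}.
have no x y x' y' : (x + y' < x' + y)%N ->
    ((x * (2 * m) + y' * (2 * m)) + 2 * m <= x' * (2 * m) + y * (2 * m))%N.
  by move=> h; rewrite -!mulnDl addnC -mulSn leq_mul2r h orbT.
have [/no|/no|] := ltngtP (a + b')%N (a' + b)%N; [lia|lia|].
by move=> /(congr1 (muln^~ (2 * m)%N)); rewrite !mulnDl; lia.
Qed.

Variables (b : CK -> CK -> R) (C : R) (m : nat).
Hypothesis bl : forall y, scalar (fun x => b x y).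
Hypothesis br : forall x, scalar (b x).
Hypothesis C_ge0 : 0 <= C.
Hypothesis b_bounded : forall x y, `|b x y| <= C * (sup_norm x * sup_norm y).
Hypothesis m_gt0 : (0 < m)%N.
Hypothesis b_local : forall (g : CK) N, (forall t, 0 <= g t <= N%:R) ->
  forall (j k : 'I_N.+1) x y, ((j + m <= k) || (k + m <= j))%N ->
  b (tent j g * x) (tent k g * y) = 0.

Let bDl x x' y : b (x + x') y = b x y + b x' y.
Proof. by have := bl y 1 x x'; rewrite /= scale1r mul1r. Qed.
Let bDr x y y' : b x (y + y') = b x y + b x y'.
Proof. by have := br x 1 y y'; rewrite /= scale1r mul1r. Qed.
Let b0l y : b 0 y = 0.
Proof. by apply: (addrI (b 0 y)); rewrite -bDl !addr0. Qed.
Let b0r x : b x 0 = 0.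
Proof. by apply: (addrI (b x 0)); rewrite -bDr !addr0. Qed.
Let bZl a x y : b (a *: x) y = a * b x y.
Proof. by have := bl y a x 0; rewrite /= addr0 b0l addr0. Qed.
Let bZr a x y : b x (a *: y) = a * b x y.
Proof. by have := br x a y 0; rewrite /= addr0 b0r addr0. Qed.
Let b_suml I (r : seq I) P F y :
  b (\sum_(i <- r | P i) F i) y = \sum_(i <- r | P i) b (F i) y.
Proof. by apply: (big_morph (b^~ y)) => [x x'|]; [exact: bDl|exact: b0l]. Qed.
Let b_sumr I (r : seq I) P F x :
  b x (\sum_(i <- r | P i) F i) = \sum_(i <- r | P i) b x (F i).
Proof. by apply: (big_morph (b x)) => [y y'|]; [exact: bDr|exact: b0r]. Qed.

Local Notation M := (2 * m)%N.

(** The difference is the sum of the (j - k) b(phi_j x, phi_k y).  Sort the pairs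
by the residues of j and k modulo 2 m: within a class j - k takes a single value
d, |d| < m, on the nonzero terms, so the class contributes
d b(Phi_r x, Phi_r' y), where Phi_r is a sum of tents and hence at most 1.  The
number of classes does not depend on [N]. *)
Lemma balanced_estimate (g : CK) N x y : (forall t, 0 <= g t <= N%:R) ->
  `|b (g * x) y - b x (g * y)| <=
    \sum_(r < M) \sum_(r' < M) m%:R * (C * (sup_norm x * sup_norm y)).
Proof.
move=> gN; pose bb (j k : 'I_N.+1) := b (tent j g * x) (tent k g * y).
have M0 : (0 < M)%N by rewrite muln_gt0.
have -> : b (g * x) y - b x (g * y) =
    \sum_(j < N.+1) \sum_(k < N.+1) (j%:R - k%:R) * bb j k.
  transitivity (\sum_(j < N.+1) \sum_(k < N.+1) j%:R * bb j k -
                \sum_(j < N.+1) \sum_(k < N.+1) k%:R * bb j k).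
    congr (_ - _).
      rewrite -{1}(tent_sumM gN) -{1}(mul1r y) -(tent_sum gN) !mulr_suml.
      rewrite b_suml; apply: eq_bigr => j _; rewrite b_sumr; apply: eq_bigr => k _.
      by rewrite scalerM bZl.
    rewrite -{1}(tent_sumM gN) -{1}(mul1r x) -(tent_sum gN) !mulr_suml.
    rewrite b_suml; apply: eq_bigr => j _; rewrite b_sumr; apply: eq_bigr => k _.
    by rewrite scalerM bZr.
  rewrite -sumrB; apply: eq_bigr => j _; rewrite -sumrB; apply: eq_bigr => k _.
  by rewrite mulrBl.
pose res (j : 'I_N.+1) : 'I_M := Ordinal (ltn_pmod j M0).
have partM (F : 'I_N.+1 -> R) : \sum_j F j = \sum_(r < M) \sum_(j | res j == r) F j.
  exact: (partition_big res predT).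
rewrite partM; apply: le_trans (ler_norm_sum _ _ _) _; apply: ler_sum => r _.
under eq_bigr do rewrite partM.
rewrite exchange_big; apply: le_trans (ler_norm_sum _ _ _) _; apply: ler_sum => r' _.
have [d [dm dP]] : exists d : R, `|d| <= m%:R /\
    forall j k, res j == r -> res k == r' -> (j%:R - k%:R) * bb j k = d * bb j k.
  have far (j k : 'I_N.+1) : ~~ ((j < k + m) && (k < j + m))%N -> bb j k = 0.
    by move=> h; apply: b_local => //; rewrite negb_and -!leqNgt orbC in h *.
  have [[j [k [jr kr jk]]]|none] := pselect (exists j k,
      [/\ res j == r, res k == r' & (j < k + m) && (k < j + m)]%N).
    exists (j%:R - k%:R); split.
      have : (j <= k + m)%N /\ (k <= j + m)%N by lia.
      by rewrite -!(ler_nat R) !natrD => -[h1 h2]; rewrite ler_norml; lra.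
    move=> j' k' j'r k'r.
    have [jk'|/far ->] := boolP ((j' < k' + m) && (k' < j' + m))%N;
      last by rewrite !mulr0.
    have : (j + k' = j' + k)%N.
      move/andP: jk => [? ?]; move/andP: jk' => [? ?].
      by apply: (@same_difference _ _ _ _ m) => //;
        [move/eqP: jr => -[jr]; move/eqP: j'r; rewrite -jr => -[]
        |move/eqP: kr => -[kr]; move/eqP: k'r; rewrite -kr => -[]].
    move/(congr1 (fun n => n%:R : R)); rewrite !natrD => e.
    by congr (_ * _); lra.
  exists 0; rewrite normr0; split=> // j k jr kr; rewrite mul0r.
  by rewrite far ?mulr0//; apply/negP => jk; apply: none; exists j, k.
pose Phi s := \sum_(j < N.+1 | res j == s) tent j g.
have Phi_le z s : sup_norm (Phi s * z) <= sup_norm z.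
  apply: sup_norm_le => // t; rewrite ctsE normrM -[leRHS]mul1r.
  apply: ler_pM => //; last exact: ler_sup_norm.
  rewrite ger0_norm cts_sumE; last by apply: sumr_ge0 => j _; exact: tent_ge0.
  rewrite -(cts1E t) -(tent_sum gN) cts_sumE [leLHS]big_mkcond; apply: ler_sum => j _.
  by case: ifP => // _; exact: tent_ge0.
have -> : \sum_(j | res j == r) \sum_(k | res k == r') (j%:R - k%:R) * bb j k =
    d * b (Phi r * x) (Phi r' * y).
  rewrite !mulr_suml b_suml mulr_sumr; apply: eq_bigr => j jr.
  by rewrite b_sumr mulr_sumr; apply: eq_bigr => k kr; exact: dP.
rewrite normrM; apply: ler_pM => //; apply: le_trans (b_bounded _ _) _.
by apply: ler_wpM2l => //; apply: ler_pM => //; exact: sup_norm_ge0.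
Qed.

(** Apply the estimate to N h and let N tend to infinity. *)
Lemma balanced01 (h x y : CK) : (forall t, 0 <= h t <= 1) -> b (h * x) y = b x (h * y).
Proof.
move=> h01; apply/eqP; rewrite -subr_eq0 -normr_le0 leNgt; apply/negP => D0.
set D := `|_| in D0.
pose E := \sum_(r < M) \sum_(r' < M) m%:R * (C * (sup_norm x * sup_norm y)).
have [N EN] : exists N : nat, E / D < N%:R.
  by exists (Num.truncn (E / D)).+1; exact: truncnS_gt.
have gN t : 0 <= (N%:R *: h) t <= N%:R.
  have /andP[h0 h1] := h01 t.
  by rewrite ctsZE mulr_ge0//= ler_piMr.
have := balanced_estimate x y gN.
rewrite !scalerM bZl bZr -mulrBr normrM normr_nat -/D -/E.
by apply/negP; rewrite -ltNge -ltr_pdivrMr.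
Qed.

Lemma balanced_mul (h x y : CK) : b (h * x) y = b x (h * y).
Proof.
pose c := sup_norm h + 1.
have c0 : 0 < c by rewrite ltr_wpDl// sup_norm_ge0.
have pos01 (u : CK) : (forall t, `|u t| <= sup_norm h) ->
    forall t, 0 <= (c^-1 *: cts_pos u) t <= 1.
  move=> uh t; rewrite ctsZE mulr_ge0 ?invr_ge0 ?(ltW c0) ?cts_pos_ge0//=.
  rewrite ler_pdivrMl// mulr1 cts_posE ge_max (ltW c0) andbT.
  by apply: le_trans (ler_norm _) _; apply: le_trans (uh t) _; rewrite lerDl.
have E1 := pos01 h (ler_sup_norm K_nonempty K_compact h).
have E2 : forall t, 0 <= (c^-1 *: cts_pos (- h)) t <= 1.
  by apply: pos01 => t; rewrite ctsNE normrN; exact: ler_sup_norm.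
have -> : h = c *: (c^-1 *: cts_pos h) - c *: (c^-1 *: cts_pos (- h)).
  by rewrite !scalerA mulfV ?gt_eqF// !scale1r -cts_posB.
rewrite -!scaleNr !mulrDl !scalerM bDl bDr !(bZl c) !(bZl (- c)) !(bZr c) !(bZr (- c)).
by rewrite -!(scalerM c^-1) !(balanced01 _ _ E1) !(balanced01 _ _ E2).
Qed.

End balanced.

Section representation.
Context {K : topologicalType} {R : realType}.
Hypothesis K_nonempty : [set: K] !=set0.
Hypothesis K_compact : compact [set: K].
Local Notation CK := (continuousType K R).

Lemma upd_swap n (v : 'I_n -> CK) i k x y : i != k ->
  [eta [eta v with i |-> x] with k |-> y] =
  [eta [eta v with k |-> y] with i |-> x] :> (_ -> _).
Proof.
move=> ik; apply: funext => l /=.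
by case: (eqVneq l k) => [->|//]; rewrite eq_sym (negPf ik).
Qed.

Lemma slot_transfer n (B : ('I_n -> CK) -> R) : multilinear B -> bounded_form B ->
  gap_vanishing B -> forall v i k (h x y : CK), i != k ->
  B [eta [eta v with i |-> h * x] with k |-> y] =
  B [eta [eta v with i |-> x] with k |-> h * y].
Proof.
move=> mB [C BC] gB v i k h x y ik.
pose b x y := B [eta [eta v with i |-> x] with k |-> y].
pose C' := `|C| * \prod_(l < n | (l != k) && (l != i)) sup_norm (v l).
apply: (@balanced_mul K R K_nonempty K_compact b C' n) => //.
- by move=> z a u w; rewrite /b !(upd_swap _ _ _ ik); exact: mB.
- by move=> z; exact: mB.
- by apply: mulr_ge0 => //; apply: prodr_ge0 => l _; exact: sup_norm_ge0.
- move=> u w; apply: le_trans (BC _) _.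
  rewrite (bigD1 k)//= eqxx (bigD1 i)//= eqxx (negPf ik).
  rewrite /C' (eq_bigr (fun l => sup_norm (v l))); last first.
    by move=> l /andP[/negPf -> /negPf ->].
  have := @prodr_ge0 _ 'I_n (index_enum _) (fun l => (l != k) && (l != i))
    (fun l => sup_norm (v l)) (fun l _ => sup_norm_ge0 K_nonempty K_compact _).
  set p := \prod_(_ | _) _ => p0.
  have -> : sup_norm w * (sup_norm u * p) = sup_norm u * sup_norm w * p by ring.
  rewrite [leRHS]mulrAC -[leRHS]mulrA; apply: ler_wpM2r; last exact: ler_norm.
  by rewrite !mulr_ge0// sup_norm_ge0.
- exact: leq_ltn_trans (leq0n i) (ltn_ord i).
move=> g N gN j l u w /orP[jl|lj].
  apply: (gap_tent mB gB gN ik _ _ jl) => /=; last by rewrite eqxx.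
  by rewrite (negPf ik) eqxx.
apply: (gap_tent mB gB gN _ _ _ lj); first by rewrite eq_sym; exact: ik.
  by rewrite /= eqxx.
by rewrite /= (negPf ik) eqxx.
Qed.

Definition bounded_functional (L : CK -> R) :=
  exists2 C, 0 <= C & forall f, `|L f| <= C * sup_norm f.

Definition pol n (L : CK -> R) : CK -> R := fun x => L (x ^+ n).

(** Once multiplications can be moved between slots, the factors of x in the
slots 1, 2, ... are moved one after the other to slot 0. *)
Theorem representation n (P : CK -> R) : (0 < n)%N -> Po n P ->
  exists L : CK -> R, [/\ scalar L, bounded_functional L & P = pol n L].
Proof.
case: n => // n _ [[A [mA bA PA]] oP].
have {}PA : P = fun x => A (fun=> x) by exact: funext.
rewrite PA in oP *; pose B := symmetrize A.
have mB : multilinear B by exact: symmetrize_multilinear.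
have bB : bounded_form B by exact: symmetrize_bounded.
have gB : gap_vanishing B by exact: symmetrize_gap.
pose f0 := n.+1`!%:R : R.
have f0_gt0 : 0 < f0 by rewrite ltr0n fact_gt0.
exists (fun f => f0^-1 * B [eta (fun=> 1) with ord0 |-> f]); split.
- by move=> a x y; rewrite mB mulrDr mulrCA.
- case: bB => C BC.
  exists (f0^-1 * (`|C| * \prod_(i < n.+1 | i != ord0) sup_norm (1 : CK))).
    rewrite !mulr_ge0 ?invr_ge0 ?(ltW f0_gt0)//.
    by apply: prodr_ge0 => l _; exact: sup_norm_ge0.
  move=> f; rewrite normrM gtr0_norm ?invr_gt0// -mulrA ler_pM2l ?invr_gt0//.
  apply: le_trans (BC _) _; rewrite (bigD1 ord0)//= mulrAC mulrA.
  rewrite (eq_bigr (fun=> sup_norm (1 : CK))); last by move=> i /negPf ->.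
  apply: ler_wpM2r; first by apply: prodr_ge0 => l _; exact: sup_norm_ge0.
  by apply: ler_wpM2r; [exact: sup_norm_ge0|exact: ler_norm].
apply: funext => x; rewrite /pol.
pose V m (i : 'I_n.+1) : CK :=
  if i == ord0 then x ^+ m.+1 else if (i <= m)%N then 1 else x.
have VE m : (m <= n)%N -> B (V m) = B (fun=> x).
  elim: m => [_|m IH mn].
    congr B; apply: funext => i; rewrite /V expr1 leqn0.
    by case: eqP => // i0; case: eqP => // ii; case: i0; exact: val_inj.
  rewrite -IH; last exact: ltnW.
  pose k := Ordinal (mn : (m.+1 < n.+1)%N).
  have k0 : ord0 != k by [].
  have := slot_transfer mB bB gB (V m) x (x ^+ m.+1) 1 k0.
  rewrite -exprS mulr1.
  have -> : [eta [eta V m with ord0 |-> x ^+ m.+2] with k |-> 1] = V m.+1 :> (_ -> _).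
    apply: funext => i; rewrite /V /=.
    case: (eqVneq i k) => [->|ik]; first by rewrite eq_sym (negPf k0) /= leqnn.
    case: eqP => // _; rewrite [(i <= m.+1)%N]leq_eqVlt ltnS.
    have -> // : (i == m.+1 :> nat) = false.
    by apply: contraNF ik => /eqP i1; apply/eqP/val_inj.
  have -> // : [eta [eta V m with ord0 |-> x ^+ m.+1] with k |-> x] = V m :> (_ -> _).
  apply: funext => i; rewrite /V /=.
  case: (eqVneq i k) => [->|_]; last by case: (i == ord0).
  by rewrite eq_sym (negPf k0) /= ltnn.
have -> : [eta (fun=> 1) with ord0 |-> x ^+ n.+1] = V n :> (_ -> _).
  by apply: funext => i; rewrite /V /= -ltnS ltn_ord.
by rewrite VE// /B symmetrize_diag mulKf// gt_eqF.
Qed.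

End representation.

(** * Positive functionals and the Jordan decomposition *)

Section functionals.
Context {K : topologicalType} {R : realType}.
Hypothesis K_nonempty : [set: K] !=set0.
Hypothesis K_compact : compact [set: K].
Local Notation CK := (continuousType K R).
Implicit Types (f g h u v x y : CK) (t : K).

Definition pack_scalar (f : CK -> R) (f_scalar : scalar f) : {scalar CK} :=
  HB.pack f (GRing.isLinear.Build R CK R *%R f f_scalar).

Definition positive (L : CK -> R) := forall f, (forall t, 0 <= f t) -> 0 <= L f.

Lemma positive_le (L : {scalar CK}) f g : positive L ->
  (forall t, f t <= g t) -> L f <= L g.
Proof.
move=> Lp fg; rewrite -subr_ge0 -linearB; apply: Lp => t.
by rewrite !ctsE subr_ge0.
Qed.

Lemma positive_norm_le (L : {scalar CK}) f g : positive L ->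
  (forall t, `|f t| <= g t) -> `|L f| <= L g.
Proof.
move=> Lp fg; rewrite ler_norml -linearN; apply/andP; split; apply: positive_le => // t.
  by rewrite ctsNE; have := fg t; rewrite ler_norml => /andP[].
by apply: le_trans (fg t); exact: ler_norm.
Qed.

Lemma positive1 (L : CK -> R) : positive L -> 0 <= L 1.
Proof. by apply=> t; exact: ler01. Qed.

Lemma positive_bounded (L : {scalar CK}) f : positive L ->
  `|L f| <= L 1 * sup_norm f.
Proof.
move=> Lp; rewrite mulrC -scalarZ; apply: positive_norm_le => // t.
by rewrite !ctsE mulr1 ler_sup_norm.
Qed.

Section jordan.
Variable L : {scalar CK}.
Hypothesis L_bounded : bounded_functional L.

(** The positive part of [L] is first built on the positive cone, as the supremum
of [L] over the order interval from 0 to [f]; [pos_ext] is its linear extension. *)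
Definition below (f : CK) : set CK := [set g | forall t, 0 <= g t <= f t].

Definition pos_part (f : CK) : R := sup (L @` below f).

Lemma below_has_sup f : (forall t, 0 <= f t) -> has_sup (L @` below f).
Proof.
move=> f0; split; first by exists (L 0), 0 => // t; rewrite cts0E lexx f0.
have [C C0 LC] := L_bounded; exists (C * sup_norm f) => _ [g gf <-].
apply: le_trans (ler_norm _) _; apply: le_trans (LC _) _; apply: ler_wpM2l => //.
apply: sup_norm_le => // t; have /andP[g0 gft] := gf t.
rewrite ger0_norm//; apply: le_trans gft _; apply: le_trans (ler_norm _) _.
exact: ler_sup_norm.
Qed.

Lemma le_pos_part f g : (forall t, 0 <= g t <= f t) -> L g <= pos_part f.
Proof.
move=> gf; apply: sup_upper_bound; last by exists g.
by apply: below_has_sup => t; have /andP[g0] := gf t; exact: le_trans.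
Qed.

Lemma pos_part_le f c : (forall t, 0 <= f t) ->
  (forall g, (forall t, 0 <= g t <= f t) -> L g <= c) -> pos_part f <= c.
Proof.
move=> f0 fc; apply: ge_sup; first by case: (below_has_sup f0).
by move=> _ [g gf <-]; exact: fc.
Qed.

(** Riesz decomposition: if 0 <= h <= f + g then h is the sum of min(h, f), below
[f], and of (h - f)^+, below [g]. *)
Lemma pos_partD f g : (forall t, 0 <= f t) -> (forall t, 0 <= g t) ->
  pos_part (f + g) = pos_part f + pos_part g.
Proof.
move=> f0 g0; apply/eqP; rewrite eq_le; apply/andP; split.
  apply: pos_part_le => [t|h hfg]; first by rewrite !ctsE addr_ge0.
  pose h2 := cts_pos (h - f).
  rewrite -(subrK h2 h) linearD; apply: lerD; apply: le_pos_part => t.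
    have /andP[h0 _] := hfg t; have := f0 t; rewrite !ctsE cts_posE !ctsE.
    by case: (leP (h t - f t) 0) => ?; lra.
  have /andP[h0 h1] := hfg t; have := g0 t; rewrite cts_posE !ctsE in h0 h1 *.
  by case: (leP (h t - f t) 0) => ?; lra.
rewrite -lerBrDr; apply: pos_part_le => // u uf.
rewrite lerBrDr -lerBrDl; apply: pos_part_le => // v vg.
rewrite lerBrDl -linearD; apply: le_pos_part => t; rewrite !ctsE.
by have := uf t; have := vg t; lra.
Qed.

Lemma pos_part0 : pos_part 0 = 0.
Proof.
apply: (addrI (pos_part 0)); rewrite -pos_partD ?addr0// => t; exact: lexx.
Qed.

Lemma pos_partZ a f : 0 <= a -> (forall t, 0 <= f t) ->
  pos_part (a *: f) = a * pos_part f.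
Proof.
rewrite le_eqVlt => /predU1P[<- f0|a0 f0].
  by rewrite scale0r mul0r pos_part0.
have half c h : 0 < c -> (forall t, 0 <= h t) -> c * pos_part h <= pos_part (c *: h).
  move=> c0 h0; rewrite -ler_pdivlMl//; apply: pos_part_le => // g gh.
  rewrite ler_pdivlMl// -scalarZ; apply: le_pos_part => t.
  have /andP[g0 g1] := gh t.
  by rewrite !ctsE mulr_ge0 ?(ltW c0)//= ler_pM2l.
apply/eqP; rewrite eq_le half// andbT.
rewrite -ler_pdivrMl//; apply: le_trans (half _ _ _ _) _; rewrite ?invr_gt0//.
  by move=> t; rewrite !ctsE mulr_ge0// ltW.
by rewrite scalerA mulVf ?gt_eqF// scale1r.
Qed.

Definition pos_ext f := pos_part (cts_pos f) - pos_part (cts_pos (- f)).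

(** The value does not depend on the way the argument is written as a difference
of nonnegative functions; linearity follows. *)
Lemma pos_extE u v : (forall t, 0 <= u t) -> (forall t, 0 <= v t) ->
  pos_ext (u - v) = pos_part u - pos_part v.
Proof.
move=> u0 v0; rewrite /pos_ext.
have : pos_part (cts_pos (u - v) + v) = pos_part (u + cts_pos (- (u - v))).
  congr pos_part; apply: (addrI (- cts_pos (- (u - v)) - v)).
  have := cts_posB (u - v); set p := cts_pos (u - v); set q := cts_pos _ => e.
  have -> : - q - v + (p + v) = p - q by ring.
  by rewrite -e; ring.
rewrite !pos_partD//; try exact: cts_pos_ge0.
by move=> ?; lra.
Qed.

Lemma pos_ext_scalar : scalar pos_ext.
Proof.
move=> a f g.
have P := @cts_pos_ge0 R K.
have PZ c h : 0 <= c -> forall t, 0 <= (c *: cts_pos h) t.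
  by move=> c0 t; rewrite ctsZE mulr_ge0 ?P.
have PD (h k : CK) : (forall t, 0 <= h t) -> (forall t, 0 <= k t) ->
    forall t, 0 <= (h + k) t.
  by move=> h0 k0 t; rewrite ctsDE addr_ge0.
rewrite /pos_ext -/(pos_ext (a *: f + g)).
have [a0|/ltW a0] := leP 0 a.
  have -> : a *: f + g = (a *: cts_pos f + cts_pos g) -
                         (a *: cts_pos (- f) + cts_pos (- g)).
    by rewrite {1}(cts_posB f) {1}(cts_posB g) scalerBr; ring.
  rewrite pos_extE; [|exact: PD _ _ (PZ _ _ a0) (P _)|exact: PD _ _ (PZ _ _ a0) (P _)].
  by rewrite !pos_partD// ?pos_partZ//; try exact: PZ; try exact: P; ring.
have Na0 : 0 <= - a by rewrite oppr_ge0.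
have -> : a *: f + g = (- a *: cts_pos (- f) + cts_pos g) -
                       (- a *: cts_pos f + cts_pos (- g)).
  rewrite {1}(cts_posB f) {1}(cts_posB g) scalerBr !scaleNr; ring.
rewrite pos_extE; [|exact: PD _ _ (PZ _ _ Na0) (P _)|exact: PD _ _ (PZ _ _ Na0) (P _)].
by rewrite !pos_partD// ?pos_partZ//; try exact: PZ; try exact: P; ring.
Qed.

(** The last property and L <= U make U(1) the supremum of L over 0 <= g <= 1,
which is what ties U to the norm of the polynomial. *)
Lemma jordan : exists U V : {scalar CK},
  [/\ positive U, positive V, forall f, L f = U f - V f &
   forall c, (forall g, (forall t, 0 <= g t <= 1) -> L g <= c) -> U 1 <= c].
Proof.
pose U := pack_scalar pos_ext_scalar.
have UE f : (forall t, 0 <= f t) -> U f = pos_part f.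
  move=> f0; rewrite -[f in LHS]subr0 [LHS]pos_extE//.
  by rewrite pos_part0 subr0.
have Vs : scalar (fun f => U f - L f).
  by move=> a x y; rewrite (linearD U) (linearD L) (scalarZ U) (scalarZ L) /=; ring.
exists U, (pack_scalar Vs); split.
- move=> f f0; rewrite UE// -[leLHS](linear0 L); apply: le_pos_part => t.
  by rewrite cts0E lexx f0.
- move=> f f0; rewrite [leRHS]/(U f - L f) subr_ge0 UE//; apply: le_pos_part => t.
  by rewrite f0 lexx.
- by move=> f; have -> : pack_scalar Vs f = U f - L f by []; rewrite opprB addrC subrK.
move=> c Lc; rewrite UE; last by move=> t; rewrite cts1E.
by apply: pos_part_le => [t|//]; rewrite cts1E.
Qed.

End jordan.
End functionals.

(** * The unit ball and characters *)

Section ball.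
Context {K : topologicalType} {R : realType}.
Hypothesis K_nonempty : [set: K] !=set0.
Hypothesis K_compact : compact [set: K].
Local Notation CK := (continuousType K R).
Implicit Types (f g h x y phi : CK) (t s : K) (L U V W : {scalar CK}).

Lemma Po_bounded n (P : CK -> R) : Po n P ->
  exists M, forall x, sup_norm x <= 1 -> `|P x| <= M.
Proof.
move=> [[A [_ [M AM] PA]] _]; exists `|M| => x x1; rewrite PA.
apply: le_trans (AM _) _; rewrite prodr_const -[leRHS]mulr1.
have xn0 : 0 <= sup_norm x by exact: sup_norm_ge0.
apply: (@le_trans _ _ (`|M| * sup_norm x ^+ #|'I_n|)).
  by rewrite ler_wpM2r ?exprn_ge0// ler_norm.
by rewrite ler_wpM2l// exprn_ile1.
Qed.

Lemma ballP n (P : CK -> R) : Po_unit_ball n P <->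
  Po n P /\ forall x, (forall t, `|x t| <= 1) -> `|P x| <= 1.
Proof.
split=> -[PoP P1]; split=> //.
  move=> x x1; apply: le_trans P1; apply: sup_upper_bound; last first.
    by exists x => //=; exact: sup_norm_le.
  split; first by exists `|P x|, x => //=; exact: sup_norm_le.
  have [M PM] := Po_bounded PoP.
  by exists M => _ [y /= y1 <-]; exact: PM.
apply: ge_sup.
  exists `|P 0|, 0 => //=.
  by apply: sup_norm_le => // t; rewrite cts0E normr0.
move=> _ [x /= x1 <-]; apply: P1 => t.
by apply: le_trans x1; exact: ler_sup_norm.
Qed.

Lemma sup_norm_prod_le n (v : 'I_n -> CK) :
  sup_norm (\prod_i v i) <= \prod_i sup_norm (v i).
Proof.
apply: sup_norm_le => // t.
elim/big_rec2: _ => [|i a b _ IH]; first by rewrite cts1E normr1.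
rewrite ctsME normrM; apply: ler_pM => //; exact: ler_sup_norm.
Qed.

Lemma pol_Po n L : (0 < n)%N -> bounded_functional L -> Po n (pol n L).
Proof.
move=> n0 [C C0 LC]; split.
  exists (fun v => L (\prod_i v i)); split.
  - move=> i v a x y /=.
    rewrite -scalarZ -linearD; congr (L _).
    have E z : \prod_(j < n) (if j == i then z else v j) =
        z * \prod_(j < n | j != i) v j.
      rewrite (bigD1 i)//= eqxx; congr (_ * _).
      by apply: eq_bigr => j /negPf ->.
    by rewrite !E mulrDl scalerM.
  - exists C => v; apply: le_trans (LC _) _; rewrite ler_wpM2l//.
    exact: sup_norm_prod_le.
  - by move=> x; rewrite prodr_const card_ord.
move=> x y xy; rewrite /pol -linearD; congr (L _).
apply: cts_eq => t; rewrite !ctsE; have := xy t.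
rewrite /Num.min; case: ifP => _ /normr0_eq0 ->.
  by rewrite add0r expr0n gtn_eqF// add0r.
by rewrite addr0 expr0n gtn_eqF// addr0.
Qed.

(** Range of the pairs (U(1), V(1)) of the elements U - V of the unit ball: for odd
n the norm of the polynomial is that of the functional, U(1) + V(1), while for
even n only the values on nonnegative functions count, and the norm is the
maximum of U(1) and V(1). *)
Definition region n (u v : R) := if odd n then u + v <= 1 else (u <= 1) && (v <= 1).

Lemma regionC n u v : region n u v -> region n v u.
Proof. by rewrite /region; case: ifP => _; [rewrite addrC|rewrite andbC]. Qed.

Definition dpol n U V : CK -> R := fun x => U (x ^+ n) - V (x ^+ n).

Lemma dpol_ball n U V : (0 < n)%N -> positive U -> positive V ->
  region n (U 1) (V 1) -> Po_unit_ball n (dpol n U V).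
Proof.
move=> n0 Up Vp rUV; apply/ballP; split.
  have Ws : scalar (fun f => U f - V f).
    by move=> a x y; rewrite (linearD U) (linearD V) (scalarZ U) (scalarZ V) /=; ring.
  apply: (pol_Po (L := pack_scalar Ws) n0).
  exists (U 1 + V 1) => [|f].
    by rewrite addr_ge0 ?positive1.
  rewrite [pack_scalar Ws f]/(U f - V f) mulrDl; apply: le_trans (ler_normB _ _) _.
  by apply: lerD; apply: positive_bounded.
move=> x x1; rewrite /dpol.
have xn1 t : `|(x ^+ n) t| <= (1 : CK) t by rewrite ctsE normrX cts1E exprn_ile1.
have := positive_norm_le Up xn1; have := positive_norm_le Vp xn1.
move: rUV; rewrite /region; case: ifP => on.
  by rewrite !ler_norml => rUV; lra.
move=> /andP[U1 V1].
have x0 t : 0 <= (x ^+ n) t by rewrite ctsE exprn_even_ge0// on.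
by have := Up _ x0; have := Vp _ x0; rewrite !ler_norml; lra.
Qed.

(** U(1) is bounded by testing L on 0 <= g <= 1.  For odd n, 2 g - 1 is an n-th
power in the unit ball, so 2 L(g) - L(1) <= 1 and 2 U(1) - L(1) = U(1) + V(1) is
at most 1.  For even n, g and 1 - g are n-th powers, so L(g) <= 1 and
L(g) - L(1) <= 1, which bounds U(1) and V(1) = U(1) - L(1). *)
Lemma ball_dpol n (P : CK -> R) : (0 < n)%N -> Po_unit_ball n P ->
  exists U V, [/\ positive U, positive V, region n (U 1) (V 1) & P = dpol n U V].
Proof.
move=> n0 /ballP[PoP P1].
have [L [Lb PL]] : exists L, bounded_functional L /\ P = pol n L.
  have [L [Ls Lb PL]] := representation K_nonempty K_compact n0 PoP.
  by exists (pack_scalar Ls).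
have [U [V [Up Vp LUV U1]]] := jordan K_nonempty K_compact Lb.
exists U, V; split => //; last first.
  by rewrite PL; apply: funext => x; exact: LUV.
have LP x f : x ^+ n = f -> (forall t, `|f t| <= 1) -> `|L f| <= 1.
  move=> <- f1; have := P1 x; rewrite PL; apply => t.
  have := f1 t; rewrite ctsE normrX => h; rewrite leNgt; apply/negP => x1.
  by move: h; rewrite leNgt exprn_egt1 ?lt0n_neq0.
have LE := LUV 1.
rewrite /region; case: ifP => on.
  suff : U 1 <= (L 1 + 1) / 2 by lra.
  apply: U1 => g g01.
  have [x xn] := cts_root_odd (2 *: g - 1) on.
  have := LP _ _ xn; rewrite ler_norml (linearB L) (scalarZ L) => h.
  suff : -1 <= 2 * L g - L 1 <= 1 by lra.
  by apply: h => t; have := g01 t; rewrite !ctsE ler_norml; lra.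
have L01 g : (forall t, 0 <= g t <= 1) -> `|L g| <= 1.
  move=> g01; have [|x xn] := @cts_rootP _ _ n g n0.
    by move=> t; have /andP[] := g01 t.
  apply: (LP _ _ xn) => t; have /andP[g0 g1] := g01 t.
  by rewrite ger0_norm.
apply/andP; split.
  by apply: U1 => g /L01; rewrite ler_norml => /andP[].
suff : U 1 <= L 1 + 1 by lra.
apply: U1 => g g01.
have : `|L (1 - g)| <= 1.
  by apply: L01 => t; have := g01 t; rewrite !ctsE; lra.
by rewrite linearB ler_norml; lra.
Qed.

Definition mul_functional L (c : R) (phi : CK) : CK -> R := fun f => c * L (phi * f).

Lemma mul_functional_scalar L c phi : scalar (mul_functional L c phi).
Proof.
move=> a x y; rewrite /mul_functional mulrDr.
have -> : phi * (a *: x) = a *: (phi * x) by rewrite mulrC scalerM mulrC.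
by rewrite (linearD L) (scalarZ L); ring.
Qed.

(** If U(1) = 0 then U = 0 by positivity.  Otherwise [U] is multiplicative up to a
scalar.  If [U] were not the multiple of the
evaluation at any t, then for each t some k in the kernel of [U] would satisfy
k(t) <> 0; the k^2 lie in the kernel too.  The nonnegative elements of the
kernel are directed upwards, so by compactness one of them is positive
everywhere, hence bounded below by a positive constant, which gives U(1) = 0. *)
Lemma character_eval U : positive U ->
  (forall phi, (forall t, 0 <= phi t <= 1) -> forall f,
     U 1 * U (phi * f) = U phi * U f) ->
  exists s, forall f, U f = U 1 * f s.
Proof.
move=> Up Um.
have [U10|U1_neq0] := eqVneq (U 1) 0.
  have [s _] := K_nonempty; exists s => f; rewrite U10 mul0r; apply/eqP.
  rewrite -normr_le0; apply: le_trans (positive_bounded _ _ _ Up) _ => //.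
  by rewrite U10 mul0r.
have U1_gt0 : 0 < U 1 by rewrite lt_def U1_neq0 positive1.
have Um_pos phi f : (forall t, 0 <= phi t) -> U 1 * U (phi * f) = U phi * U f.
  move=> phi0; pose c := sup_norm phi + 1.
  have c0 : 0 < c by rewrite ltr_wpDl// sup_norm_ge0.
  have := @Um (c^-1 *: phi) _ f; rewrite scalerM !scalarZ => /(_ _) h.
  apply: (mulfI (invr_neq0 (lt0r_neq0 c0))); rewrite mulrCA h ?mulrA// => t.
  rewrite ctsZE mulr_ge0 ?invr_ge0 ?(ltW c0)//= ler_pdivrMl// mulr1.
  apply: le_trans (ler_norm _) _.
  apply: le_trans (ler_sup_norm K_nonempty K_compact _ _) _.
  by rewrite lerDl.
have {Um Um_pos} Um phi f : U 1 * U (phi * f) = U phi * U f.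
  rewrite (cts_posB phi) mulrBl !(linearB U) mulrBr mulrBl.
  by rewrite !Um_pos//; exact: cts_pos_ge0.
apply: contrapT => none.
pose D := [set g : CK | (forall t, 0 <= g t) /\ U g = 0].
pose F := filter_from D (fun g => [set h | D h /\ forall t, g t <= h t]).
have FF : Filter F.
  apply: filter_from_filter; first by exists 0; split=> //; exact: linear0.
  move=> g1 g2 [g10 Ug1] [g20 Ug2]; exists (g1 + g2).
    split=> [t|]; first by rewrite ctsDE addr_ge0.
    by rewrite (linearD U) Ug1 Ug2 addr0.
  move=> h [Dh gh]; split; split=> // t; apply: le_trans (gh t);
    by rewrite ctsDE ?lerDl ?lerDr.
have cov t : [set: K] t -> \forall t' \near t & h \near F, 0 < (h : CK) t'.
  move=> _; have /existsNP[f fP] : ~ forall f, U f = U 1 * f t.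
    by move=> h; apply: none; exists t.
  pose k := f - (U f / U 1) *: (1 : CK).
  have Uk : U k = 0 by rewrite linearB scalarZ divfK// subrr.
  have kt : k t != 0.
    apply: contra_not_neq fP; rewrite /k !ctsE mulr1 => /subr0_eq ->.
    by rewrite mulrC divfK.
  have Dkk : D (k * k).
    split; first by move=> t'; rewrite ctsE -expr2 sqr_ge0.
    by apply: (mulfI U1_neq0); rewrite Um Uk !mulr0.
  exists ([set t' | 0 < (k * k) t'], [set h | D h /\ forall t, (k * k) t <= h t]).
    split; last by exists (k * k).
    have kkt : 0 < (k * k) t by rewrite ctsME -expr2 lt_def sqrf_eq0 kt sqr_ge0.
    by apply: (@cts_fun _ _ (k * k) t [set r | 0 < r]); exact: lt_nbhsr.
  by move=> [t' h] [/= kk0 [_ kh]]; exact: lt_le_trans (kh t').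
have [g Dg gF] := (compact_near_coveringP _).1 K_compact _ _
  (fun (h : CK) t => 0 < h t) FF cov.
have G_gt0 t : 0 < g t by apply: gF => //; split.
have UG : U g = 0 by case: Dg.
have cG : {within [set: K], continuous g}.
  by apply/continuous_subspaceT => t; exact: cts_fun.
have [t0 _ Gmin] := compact_EVT_min K_nonempty K_compact cG.
have : U (g t0 *: (1 : CK)) <= U g.
  by apply: positive_le => // t; rewrite ctsE mulr1 Gmin// inE.
by rewrite UG scalarZ leNgt mulr_gt0.
Qed.

End ball.

(** * Decompositions of extreme points *)

Section extreme.
Context {K : topologicalType} {R : realType}.
Hypothesis K_nonempty : [set: K] !=set0.
Hypothesis K_compact : compact [set: K].
Local Notation CK := (continuousType K R).
Implicit Types (f g h x y phi : CK) (t s : K) (L U V W : {scalar CK}) (P : CK -> R).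
Variable n : nat.
Hypothesis n_gt0 : (0 < n)%N.
Local Notation ball := (@Po_unit_ball K R n).

Lemma extremeE P : extreme_points ball P <-> ball P /\
  forall Q S (a : R), ball Q -> ball S -> 0 < a < 1 ->
    (forall x, P x = a * Q x + (1 - a) * S x) -> Q = P /\ S = P.
Proof.
split=> -[bP eP]; split=> // Q S a bQ bS a01 PE.
  by apply: (eP Q S a) => //; exact: funext.
by apply: (eP Q S a) => // x; rewrite PE.
Qed.

Lemma ballN P : ball P -> ball (- P).
Proof.
move=> /(ball_dpol K_nonempty K_compact n_gt0)[U [V [Up Vp rUV ->]]].
have -> : - dpol n U V = dpol n V U by apply: funext => x; exact: opprB.
by apply: dpol_ball => //; exact: regionC.
Qed.

Lemma extremeN P : extreme_points ball P -> extreme_points ball (- P).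
Proof.
move=> /extremeE[bP eP]; apply/extremeE; split; first exact: ballN.
move=> Q S a bQ bS a01 PE.
have [eQ eS] : - Q = P /\ - S = P; last first.
  by split; [rewrite -eQ opprK|rewrite -eS opprK].
apply: (eP _ _ a) => //; try exact: ballN.
move=> x; have e : - P x = a * Q x + (1 - a) * S x := PE x.
by rewrite -[LHS]opprK e -[(- Q) x]/(- Q x) -[(- S) x]/(- S x); ring.
Qed.

(** Nonnegative functions are n-th powers, so the polynomial determines the
functional. *)
Lemma scalar_root_eq U V : (forall x, U (x ^+ n) = V (x ^+ n)) -> U =1 V.
Proof.
move=> UV f; rewrite (cts_posB f) (linearB U) (linearB V).
have [x <-] := cts_rootP n_gt0 (cts_pos_ge0 f).
by have [y <-] := cts_rootP n_gt0 (cts_pos_ge0 (- f)); rewrite !UV.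
Qed.

Definition cut U (c : R) phi : {scalar CK} :=
  pack_scalar (mul_functional_scalar U c phi).

Lemma cutE U c phi f : cut U c phi f = c * U (phi * f).
Proof. by []. Qed.

Lemma cut_pos U c phi : positive U -> 0 <= c -> (forall t, 0 <= phi t) ->
  positive (cut U c phi).
Proof.
move=> Up c0 phi0 f f0; rewrite cutE mulr_ge0// Up// => t.
by rewrite ctsE mulr_ge0.
Qed.

Lemma positive_null U phi f : positive U -> (forall t, 0 <= phi t) -> U phi = 0 ->
  U (phi * f) = 0.
Proof.
move=> Up phi0 U0; apply/eqP; rewrite -normr_le0.
rewrite -[leRHS](mulr0 (sup_norm f)) -U0 -scalarZ.
apply: positive_norm_le => // t; rewrite !ctsE normrM mulrC (ger0_norm (phi0 t)).
by rewrite ler_wpM2r// ler_sup_norm.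
Qed.

(** If 0 < U(phi) < U(1), both cut-off functionals, rescaled to have the value U(1)
at 1, give elements of the ball, and extremality identifies the first one with
U - V.  If U(phi) or U(1 - phi) is 0, positivity gives the equality directly. *)
Lemma extreme_multiplicative U V : positive U -> positive V ->
  region n (U 1) (V 1) -> extreme_points ball (dpol n U V) ->
  forall phi, (forall t, 0 <= phi t <= 1) -> forall f,
    U 1 * U (phi * f) = U phi * U f.
Proof.
move=> Up Vp rUV /extremeE[_ eP] phi phi01 f.
have phi0 t : 0 <= phi t by have /andP[] := phi01 t.
have psi0 t : 0 <= (1 - phi) t by rewrite !ctsE subr_ge0; have /andP[] := phi01 t.
have Upsi : U (1 - phi) = U 1 - U phi by exact: (linearB U).
have [U0|Uphi_neq0] := eqVneq (U phi) 0.
  by rewrite U0 positive_null// mulr0 mul0r.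
have [U0|Upsi_neq0] := eqVneq (U (1 - phi)) 0.
  have := positive_null f Up psi0 U0.
  rewrite mulrBl mul1r (linearB U) => /subr0_eq <-.
  by move: U0; rewrite Upsi => /subr0_eq ->.
have Uphi_gt0 : 0 < U phi by rewrite lt_def Uphi_neq0 Up.
have Upsi_gt0 : 0 < U (1 - phi) by rewrite lt_def Upsi_neq0 Up.
have lt_phi1 : U phi < U 1 by rewrite -subr_gt0 -Upsi.
have U1_gt0 : 0 < U 1 by exact: lt_trans lt_phi1.
pose a := U phi / U 1.
have a0 : 0 < a by rewrite divr_gt0.
have a1 : 0 < 1 - a by rewrite subr_gt0 ltr_pdivrMr// mul1r.
have U1_neq0 := lt0r_neq0 U1_gt0.
have aphi : a^-1 * U phi = U 1 by rewrite invf_div divfK.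
have bpsi : (1 - a)^-1 * U (1 - phi) = U 1.
  have -> : 1 - a = U (1 - phi) / U 1 by rewrite Upsi mulrBl divff.
  by rewrite invf_div divfK.
have [||||E _] := eP (dpol n (cut U a^-1 phi) V)
    (dpol n (cut U (1 - a)^-1 (1 - phi)) V) a.
- apply: dpol_ball => //; first by apply: cut_pos; rewrite // invr_ge0 ltW.
  by rewrite cutE mulr1 aphi.
- apply: dpol_ball => //; first by apply: cut_pos; rewrite // invr_ge0 ltW.
  by rewrite cutE mulr1 bpsi.
- by rewrite a0 -subr_gt0.
- move=> x; have E : (1 - phi) * x ^+ n = x ^+ n - phi * x ^+ n.
    by rewrite mulrBl mul1r.
  rewrite /dpol !cutE E (linearB U).
  by field; rewrite !lt0r_neq0.
have UE : cut U a^-1 phi =1 U.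
  apply: scalar_root_eq => x; have := congr1 (@^~ x) E; rewrite /dpol /=.
  exact: addIr.
have := UE f; rewrite cutE => /(canRL (mulVKf (lt0r_neq0 a0))) ->.
by rewrite /a; field.
Qed.

End extreme.

(** * Classification of the extreme points *)

Section classification.
Context {K : topologicalType} {R : realType}.
Hypothesis K_nonempty : [set: K] !=set0.
Hypothesis K_compact : compact [set: K].
Local Notation CK := (continuousType K R).
Implicit Types (f g h x y phi : CK) (t s : K) (L U V W : {scalar CK}) (P : CK -> R).
Variable n : nat.
Hypothesis n_gt0 : (0 < n)%N.
Local Notation ball := (@Po_unit_ball K R n).

Definition point_mass (p : R) s : CK -> R := fun f => p * f s.

Lemma point_mass_scalar p s : scalar (point_mass p s).
Proof. by move=> a x y; rewrite /point_mass !ctsE; ring. Qed.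

Definition two_masses p s q t : CK -> R := fun x => p * x s ^+ n - q * x t ^+ n.

Lemma two_masses_ball p s q t : 0 <= p -> 0 <= q -> region n p q ->
  ball (two_masses p s q t).
Proof.
move=> p0 q0 rpq; pose pm c r := pack_scalar (point_mass_scalar c r).
have -> : two_masses p s q t = dpol n (pm p s) (pm q t).
  by apply: funext => x; rewrite /two_masses -!ctsXE.
have pos c r : 0 <= c -> positive (pm c r) by move=> c0 f f0; exact: mulr_ge0.
have pm1 c r : pm c r 1 = c by exact: mulr1.
by apply: dpol_ball => //; rewrite ?pm1//; exact: pos.
Qed.

Lemma delta_pow_ball t : ball (delta_pow n t).
Proof.
have -> : delta_pow n t = two_masses 1 t 0 t :> (CK -> R).
  by apply: funext => x; rewrite /two_masses mul1r mul0r subr0.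
by apply: two_masses_ball; rewrite ?ler01// /region addr0 lexx ler01 if_same.
Qed.

Lemma zero_not_extreme : ~ extreme_points ball (0 : CK -> R).
Proof.
case: K_nonempty => t _ /extremeE[_ /(_ (delta_pow n t) (- delta_pow n t) (1/2))].
case.
- exact: delta_pow_ball.
- by apply: ballN => //; exact: delta_pow_ball.
- by lra.
- move=> x; rewrite -[(- delta_pow n t) x]/(- delta_pow n t x).
  by rewrite -[LHS]/(0 : R); field.
move=> /(congr1 (@^~ 1)) + _; rewrite /delta_pow -ctsXE expr1n => /eqP.
by rewrite cts1E -[X in _ == X]/(0 : R) oner_eq0.
Qed.

Lemma extreme_two_masses P : extreme_points ball P ->
  exists p s q t, [/\ 0 <= p, 0 <= q, region n p q & P = two_masses p s q t].
Proof.
move=> eP; have [bP _] := (extremeE _ _).1 eP.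
have [U [V [Up Vp rUV PE]]] := ball_dpol K_nonempty K_compact n_gt0 bP.
have [s Us] := character_eval K_nonempty K_compact Up
  (extreme_multiplicative K_nonempty K_compact n_gt0 Up Vp rUV
     (eq_ind _ _ eP _ PE)).
have NPE : - P = dpol n V U by rewrite PE; apply: funext => x; exact: opprB.
have [t Vt] := character_eval K_nonempty K_compact Vp
  (extreme_multiplicative K_nonempty K_compact n_gt0 Vp Up (regionC rUV)
     (eq_ind _ _ (extremeN K_nonempty K_compact n_gt0 eP) _ NPE)).
exists (U 1), s, (V 1), t; split; try exact: positive1; first exact: rUV.
by rewrite PE; apply: funext => x; rewrite /dpol Us Vt !ctsXE.
Qed.

(** The point (p, q) of the triangle or square lies on the segment joining
(1, q1) to (0, q2), with weights p and 1 - p; the two ends differ on the constant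
function 1. *)
Lemma two_masses_extreme01 p s q t : 0 <= p -> 0 <= q -> region n p q ->
  extreme_points ball (two_masses p s q t) -> p = 0 \/ p = 1.
Proof.
move=> p0 q0 rpq /extremeE[_ eP].
have [->|p_neq0] := eqVneq p 0; first by left.
have [->|p_neq1] := eqVneq p 1; first by right.
have p_le1 : p <= 1 by move: rpq; rewrite /region; case: ifP => _; [lra|case/andP].
have p_gt0 : 0 < p by rewrite lt_def p_neq0.
have p_lt1 : p < 1 by rewrite lt_def eq_sym p_neq1.
have [q1 [q2 [q1_ge0 q2_ge0 r1 r2 [qE q12]]]] : exists q1 q2, [/\ 0 <= q1, 0 <= q2,
    region n 1 q1, region n 0 q2 & q = p * q1 + (1 - p) * q2 /\ 1 - q1 <> - q2].
  rewrite /region in rpq *; case: (odd n) rpq => rpq.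
    exists 0, (q / (1 - p)); have h : 0 <= q / (1 - p) by rewrite divr_ge0// subr_ge0.
    split=> //.
      by rewrite add0r ler_pdivrMr ?subr_gt0//; lra.
    by split; [field; lra|lra].
  by exists q, q; case/andP: rpq => _ q_le1; split; rewrite ?lexx ?ler01//; lra.
have [||||] := eP (two_masses 1 s q1 t) (two_masses 0 s q2 t) p.
- exact: two_masses_ball.
- exact: two_masses_ball.
- by rewrite p_gt0.
- by move=> x; rewrite /two_masses qE; ring.
move=> <- /(congr1 (@^~ 1)); rewrite /two_masses -!ctsXE expr1n !cts1E => e.
by case: q12; lra.
Qed.

Lemma extreme_classification P : extreme_points ball P ->
  (exists t : K, P = delta_pow n t \/ P = - delta_pow n t) \/
  ~~ odd n /\ (exists s t : K, s <> t /\ P = delta_pow n s - delta_pow n t).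
Proof.
move=> eP; have [p [s [q [t [p0 q0 rpq PE]]]]] := extreme_two_masses eP.
rewrite PE in eP.
have p01 := two_masses_extreme01 p0 q0 rpq eP.
have NE : - two_masses p s q t = two_masses q t p s.
  by apply: funext => x; exact: opprB.
have q01 : q = 0 \/ q = 1.
  apply: (two_masses_extreme01 q0 p0 (regionC rpq) (s := t) (t := s)).
  by rewrite -NE; exact: extremeN.
have zeroE : two_masses 0 s 0 t = 0.
  by apply: funext => x; rewrite /two_masses !mul0r subr0.
case: p01 q01 => pE [] qE; rewrite {}pE {}qE in rpq eP PE.
- by case: zero_not_extreme; rewrite -zeroE.
- left; exists t; right; rewrite PE; apply: funext => x.
  by rewrite /two_masses mul0r mul1r sub0r.
- left; exists s; left; rewrite PE; apply: funext => x.
  by rewrite /two_masses mul0r mul1r subr0.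
right; split.
  by apply/negP => on; move: rpq; rewrite /region on; lra.
exists s, t; split.
  move=> st; case: zero_not_extreme; congr (extreme_points _ _): eP.
  by apply: funext => x; rewrite /two_masses st subrr.
by rewrite PE; apply: funext => x; rewrite /two_masses !mul1r.
Qed.

(** Apply the hypothesis to the positive and negative parts, rescaled, of
f - f(s). *)
Lemma positive_supported U s : positive U ->
  (forall g, (forall t, 0 <= g t <= 1) -> g s = 0 -> U g = 0) ->
  forall f, U f = U 1 * f s.
Proof.
move=> Up U0 f.
have U0' g : (forall t, 0 <= g t) -> g s = 0 -> U g = 0.
  move=> g0 gs; pose c := sup_norm g + 1.
  have c0 : 0 < c by rewrite ltr_wpDl// sup_norm_ge0.
  have : U (c^-1 *: g) = 0.
    apply: U0 => [t|]; last by rewrite ctsE gs mulr0.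
    rewrite ctsZE mulr_ge0 ?invr_ge0 ?(ltW c0)//= ler_pdivrMl// mulr1.
    apply: le_trans (ler_norm _) _.
    by apply: le_trans (ler_sup_norm K_nonempty K_compact _ _) _; rewrite lerDl.
  rewrite scalarZ => /eqP; rewrite mulf_eq0 invr_eq0 (gt_eqF c0)/= => /eqP; exact.
pose h := f - f s *: (1 : CK).
have hs : h s = 0 by rewrite /h !ctsE mulr1 subrr.
have : U h = 0.
  rewrite (cts_posB h) (linearB U) !U0' ?subr0//; try exact: cts_pos_ge0.
    by rewrite cts_posE ctsNE hs oppr0 maxxx.
  by rewrite cts_posE hs maxxx.
by rewrite /h (linearB U) (scalarZ U) => /subr0_eq ->; rewrite mulrC.
Qed.

Lemma region_le1 (p q : R) : 0 <= p -> 0 <= q -> region n p q -> p <= 1 /\ q <= 1.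
Proof. by rewrite /region => p0 q0; case: ifP => _; [lra|case/andP]. Qed.

Lemma convex_max1 (a u v : R) : 0 < a < 1 -> u <= 1 -> v <= 1 ->
  a * u + (1 - a) * v = 1 -> u = 1 /\ v = 1.
Proof. by move=> /andP[a0 a1] u1 v1 e; split; nra. Qed.

(** At the constant 1 both elements must attain the value 1, so their components V
vanish and their components U, U' satisfy a U + (1 - a) U' = delta_t, whence
U is supported at t. *)
Lemma delta_pow_decomposition t (Q S : CK -> R) a : ball Q -> ball S -> 0 < a < 1 ->
  (forall x, delta_pow n t x = a * Q x + (1 - a) * S x) -> Q = delta_pow n t.
Proof.
move=> /(ball_dpol K_nonempty K_compact n_gt0)[U [V [Up Vp rUV ->]]].
move=> /(ball_dpol K_nonempty K_compact n_gt0)[U' [V' [Up' Vp' rUV' ->]]].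
move=> a01 E.
have EU f : (forall t, 0 <= f t) ->
    f t = a * (U f - V f) + (1 - a) * (U' f - V' f).
  by move=> f0; have [x <-] := cts_rootP n_gt0 f0; rewrite ctsXE; exact: E.
have [U1 V1] := region_le1 (positive1 Up) (positive1 Vp) rUV.
have [U1' V1'] := region_le1 (positive1 Up') (positive1 Vp') rUV'.
have V0 := positive1 Vp; have V0' := positive1 Vp'.
have [e e'] : U 1 - V 1 = 1 /\ U' 1 - V' 1 = 1.
  apply: (convex_max1 a01); rewrite ?lerBlDr ?(le_trans U1) ?(le_trans U1') ?lerDl//.
  by rewrite -EU// => r; exact: ler01.
have UE : U 1 = 1 by lra.
have V10 : V 1 = 0 by lra.
have V10' : V' 1 = 0 by lra.
have Vz f : V f = 0 by rewrite -(mul1r f) positive_null// => r; exact: ler01.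
have Vz' f : V' f = 0 by rewrite -(mul1r f) positive_null// => r; exact: ler01.
apply: funext => x; rewrite /dpol Vz subr0 (@positive_supported U t)//.
  by rewrite UE mul1r ctsXE.
move=> g g01 gt; have g0 r : 0 <= g r by have /andP[] := g01 r.
have := EU g g0; rewrite gt Vz Vz' !subr0.
have := Up g g0; have := Up' g g0; case/andP: a01; nra.
Qed.

Lemma delta_pow_extreme t : extreme_points ball (delta_pow n t).
Proof.
apply/extremeE; split; first exact: delta_pow_ball.
move=> Q S a bQ bS a01 E; split; first exact: (delta_pow_decomposition bQ bS a01 E).
apply: (@delta_pow_decomposition t S Q (1 - a)) => //; first by lra.
by move=> x; rewrite E; ring.
Qed.

Hypothesis K_hausdorff : hausdorff_space K.

Lemma separate_points s t : s <> t ->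
  exists f, [/\ forall r, 0 <= f r <= 1, f s = 1 & f t = 0].
Proof.
move=> st; have clos := accessible_closed_set1 (hausdorff_accessible K_hausdorff).
have : uniform_separator [set t] [set s].
  apply: ((@normal_separatorP R K).1 (compact_normal K_hausdorff K_compact)) => //.
  by rewrite -subset0 => r [/= -> ts]; apply: st.
move=> /(uniform_separatorP (R := R))[f [cf f01 f0 f1]].
exists (mkcts cf); split.
- by move=> r; have := f01 (f r); rewrite /= in_itv; apply; exists r.
- by apply: f1; exists s.
- by apply: f0; exists t.
Qed.

(** Every f with 0 <= f <= 1, f(s) = 1 and f(t) = 0 forces U(f) = 1 and V(f) = 0.
If 0 <= g <= 1 vanishes at s, then f (1 - g) is another such function and
g <= 1 - f (1 - g), so U(g) <= U(1) - 1 = 0.  If g vanishes at t, then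
1 - (1 - f) (1 - g) is one and dominates g, so V(g) = 0. *)
Lemma difference_decomposition s t (Q S : CK -> R) a : s <> t ->
  ball Q -> ball S -> 0 < a < 1 ->
  (forall x, delta_pow n s x - delta_pow n t x = a * Q x + (1 - a) * S x) ->
  Q = delta_pow n s - delta_pow n t.
Proof.
move=> st.
move=> /(ball_dpol K_nonempty K_compact n_gt0)[U [V [Up Vp rUV ->]]].
move=> /(ball_dpol K_nonempty K_compact n_gt0)[U' [V' [Up' Vp' rUV' ->]]].
move=> a01 E.
have EU f : (forall t, 0 <= f t) ->
    f s - f t = a * (U f - V f) + (1 - a) * (U' f - V' f).
  by move=> f0; have [x <-] := cts_rootP n_gt0 f0; rewrite !ctsXE; exact: E.
have [U1 V1] := region_le1 (positive1 Up) (positive1 Vp) rUV.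
have [U1' V1'] := region_le1 (positive1 Up') (positive1 Vp') rUV'.
have peak f : (forall r, 0 <= f r <= 1) -> f s = 1 -> f t = 0 ->
    U f = 1 /\ V f = 0.
  move=> f01 fs ft; have f0 r : 0 <= f r by have /andP[] := f01 r.
  have f1 r : f r <= (1 : CK) r by have /andP[] := f01 r.
  have := EU f f0; rewrite fs ft subr0 => e.
  have := positive_le Up f1; have := positive_le Up' f1.
  have := Vp f f0; have := Vp' f f0 => h1 h2 h3 h4.
  have [||eU _] := convex_max1 a01 _ _ (esym e); lra.
have valley f : (forall r, 0 <= f r <= 1) -> f s = 0 -> f t = 1 -> V f = 1.
  move=> f01 fs ft; have f0 r : 0 <= f r by have /andP[] := f01 r.
  have f1 r : f r <= (1 : CK) r by have /andP[] := f01 r.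
  have := EU f f0; rewrite fs ft sub0r => e.
  have := positive_le Vp f1; have := positive_le Vp' f1.
  have := Up f f0; have := Up' f f0 => h1 h2 h3 h4.
  by have [|||eV _] := @convex_max1 a (V f - U f) (V' f - U' f) a01; lra.
have [f [f01 fs ft]] := separate_points st.
have [Uf Vf] := peak f f01 fs ft.
have f0 r : 0 <= f r by have /andP[] := f01 r.
have f1 r : f r <= (1 : CK) r by have /andP[] := f01 r.
have UE : U 1 = 1 by have := positive_le Up f1; lra.
have VE : V 1 = 1.
  have nf01 r : 0 <= (1 - f) r <= 1 by have := f01 r; rewrite !ctsE; lra.
  have nf1 r : (1 - f) r <= (1 : CK) r by have := f01 r; rewrite !ctsE; lra.
  have : V (1 - f) = 1 by apply: valley; rewrite // !ctsE ?fs ?ft; lra.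
  by have := positive_le Vp nf1; lra.
apply: funext => x; rewrite -[RHS]/(x s ^+ n - x t ^+ n) /dpol.
rewrite (@positive_supported U s)//; last first.
  move=> g g01 gs; have g0 r : 0 <= g r by have /andP[] := g01 r.
  have h01 r : 0 <= (f * (1 - g)) r <= 1.
    by have := f01 r; have := g01 r; rewrite !ctsE; nra.
  have [Uh _] : U (f * (1 - g)) = 1 /\ V (f * (1 - g)) = 0.
    by apply: peak; rewrite // !ctsE ?fs ?ft ?gs; lra.
  have gh r : g r <= (1 - f * (1 - g)) r.
    by have := f01 r; have := g01 r; rewrite !ctsE; nra.
  by have := positive_le Up gh; rewrite (linearB U) UE Uh; have := Up g g0; lra.
rewrite (@positive_supported V t)//; last first.
  move=> g g01 gt; have g0 r : 0 <= g r by have /andP[] := g01 r.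
  pose h := 1 - (1 - f) * (1 - g).
  have h01 r : 0 <= h r <= 1.
    by have := f01 r; have := g01 r; rewrite /h !ctsE; nra.
  have [_ Vh] : U h = 1 /\ V h = 0.
    by apply: peak; rewrite // /h !ctsE ?fs ?ft ?gt; lra.
  have gh r : g r <= h r.
    by have := f01 r; have := g01 r; rewrite /h !ctsE; nra.
  by have := positive_le Vp gh; rewrite Vh; have := Vp g g0; lra.
by rewrite UE VE !mul1r !ctsXE.
Qed.

Lemma difference_extreme s t : ~~ odd n -> s <> t ->
  extreme_points ball (delta_pow n s - delta_pow n t).
Proof.
move=> en st; apply/extremeE; split.
  have -> : delta_pow n s - delta_pow n t = two_masses 1 s 1 t :> (CK -> R).
    by apply: funext => x; rewrite /two_masses !mul1r.
  by apply: two_masses_ball; rewrite ?ler01// /region (negPf en) lexx.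
move=> Q S a bQ bS a01 E; split.
  exact: (difference_decomposition st bQ bS a01 E).
apply: (@difference_decomposition s t S Q (1 - a)) => //; first by lra.
by move=> x; rewrite [LHS]E; ring.
Qed.

End classification.

Unset Implicit Arguments.

Theorem corollary3 (R : realType) (K : topologicalType)
    (K_nonempty : [set: K] !=set0) (K_compact : compact [set: K])
    (K_hausdorff : hausdorff_space K) (n : nat) (n_gt0 : (0 < n)%N) :
  (odd n ->
   forall P : continuousType K R -> R,
     extreme_points (Po_unit_ball n) P <->
     exists t : K, P = delta_pow n t \/ P = - delta_pow n t)
  /\
  (~~ odd n ->
   forall P : continuousType K R -> R,
     extreme_points (Po_unit_ball n) P <->
     (exists t : K, P = delta_pow n t \/ P = - delta_pow n t) \/
     (exists s t : K, s <> t /\ P = delta_pow n s - delta_pow n t)).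
Proof.
have deltas P : (exists t : K, P = delta_pow n t \/ P = - delta_pow n t) ->
    extreme_points (@Po_unit_ball K R n) P.
  move=> [t [->|->]]; last apply: (extremeN K_nonempty K_compact n_gt0);
    exact: delta_pow_extreme.
split=> parity P; split.
- move=> /(extreme_classification K_nonempty K_compact n_gt0)[//|[]].
  by rewrite parity.
- exact: deltas.
- by move=> /(extreme_classification K_nonempty K_compact n_gt0)[|[]]; [left|right].
- move=> [|[s [t [st ->]]]]; first exact: deltas.
  exact: difference_extreme.
Qed.
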